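(* Let $\mathcal A:L^2([0,1]^N,\mathbb C^M)\to L^2([0,1]^N,\mathbb C^M)$ be an operator of the form $$\mathcal A\mathbf u=\mathbf A_0\mathbf u+\mathbf A_1\langle \mathbf u\rangle_1+\mathbf A_2\langle \mathbf u\rangle_{1,2}+\dots+\mathbf A_N\langle\mathbf u\rangle_{1,N},$$ where each $\mathbf A_j=\mathbf A_j(\mathbf k_j)$, $0\le j\le N$, is a continuous $M\times M$ matrix-valued function depending only on $\mathbf k_j=(k_{j+1},\dots,k_N)\in[0,1]^{N-j}$ (in particular, $\mathbf A_N$ is a constant matrix). Then the spectrum of $\mathcal A$ is $$\sigma(\mathcal A)=\bigcup_{j=0}^N\sigma_j,\qquad \sigma_j=\{\lambda:\ \det\mathbf G_j(\lambda,\mathbf k_j)=0\ \text{for some}\ \mathbf k_j\in[0,1]^{N-j}\},$$ where $$\mathbf G_0\equiv\mathbf F_0,\qquad \mathbf G_j\equiv\langle\mathbf F_{j-1}^{-1}\rangle_j\mathbf F_j=\mathbf I+\langle\mathbf F_{j-1}^{-1}\rangle_j\mathbf A_j,\quad j\ge1,$$ and the $\mathbf F_j=\mathbf F_j(\lambda,\mathbf k_j)$ are the matrix-valued integral continued fractions defined in the context.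
   Context: Notation: $N,M\ge1$ are integers; $\mathbf k=(k_1,\dots,k_N)\in[0,1]^N$, $\mathbf k_j=(k_{j+1},\dots,k_N)$, $\mathbf k_0=\mathbf k$; functions of $\mathbf k_N$ are constants. $\langle\cdot\rangle_{i,j}=\int_{[0,1]^{j-i+1}}\cdot\,dk_i\,dk_{i+1}\cdots dk_j$ for $j>i$, and $\langle\cdot\rangle_i=\langle\cdot\rangle_{i,i}=\int_0^1\cdot\,dk_i$ (entrywise integration for vectors and matrices). $\mathbf I$ is the $M\times M$ identity matrix. Continued fractions: for $\lambda\in\mathbb C$, $\mathbf F_j=\mathbf F_j(\lambda,\mathbf k_j)$ is defined by $\mathbf F_0=\mathbf A_0-\lambda\mathbf I$ and $\mathbf F_j=\mathbf A_j+\langle\mathbf F_{j-1}^{-1}\rangle_j^{-1}$ for $j=1,\dots,N$, where the inverses are matrix inverses. Domains: the sets $\sigma_0,\sigma_1,\dots,\sigma_N$ are determined successively. On the $j$-th step $\mathbf G_j(\lambda,\cdot)$ is considered for $\lambda\in\mathbb C\setminus(\sigma_0\cup\dots\cup\sigma_{j-1})$, and its zeroes (the zeroes of its determinant) determine $\sigma_j$, which is then disjoint from $\sigma_0,\dots,\sigma_{j-1}$.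
   Formalization: Where ⟨F_{j-1}^{-1}⟩_j is singular, so that F_j is undefined (possible outside σ_0,…,σ_{j-1}), F_j^{-1} is read as G_j^{-1}⟨F_{j-1}^{-1}⟩_j, which equals the inverse of F_j whenever F_j exists. *)

(* Defs.v *)
From HB Require Import structures.
From mathcomp Require Import all_boot all_order all_algebra.
From mathcomp Require Import all_classical all_reals all_analysis.
From mathcomp Require Import complex.

Set Implicit Arguments.
Unset Strict Implicit.
Unset Printing Implicit Defensive.
Import Order.TTheory GRing.Theory Num.Theory.
Import numFieldNormedType.Exports.

Local Open Scope classical_set_scope.
Local Open Scope ring_scope.

(* The variables k_1, ..., k_N are the entries of an N-tuple k, numbered from 0:
   k_i is entry i - 1 of k, and (k_{j+1}, ..., k_N) is [drop j k]. *)
Notation coords R n := (n.-tuple (measurableTypeR R)).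

Section product_probability_step.
Local Open Scope ereal_scope.
Context d (T : measurableType d) (R : realType) (n : nat).
Variables (P : probability T R) (Q : probability (n.-tuple T) R).

Definition tuple_cons (p : T * n.-tuple T) : n.+1.-tuple T :=
  [tuple of p.1 :: p.2].

Lemma measurable_tuple_cons : measurable_fun setT tuple_cons.
Proof. exact: measurable_cons. Qed.

Definition tuple_prod : set (n.+1.-tuple T) -> \bar R :=
  pushforward (P \x Q) tuple_cons.

Let pm : {measure set (n.+1.-tuple T) -> \bar R} :=
  measure_function_pushforward__canonical__measure_function_Measure
    (P \x Q) measurable_tuple_cons.

Let tuple_prod0 : tuple_prod set0 = 0. Proof. exact: (measure0 pm). Qed.

Let tuple_prod_ge0 A : 0 <= tuple_prod A. Proof. exact: (measure_ge0 pm). Qed.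

Let tuple_prod_sigma_additive : semi_sigma_additive tuple_prod.
Proof. exact: (@measure_semi_sigma_additive _ _ _ pm). Qed.

HB.instance Definition _ := isMeasure.Build _ _ _ tuple_prod
  tuple_prod0 tuple_prod_ge0 tuple_prod_sigma_additive.

Let tuple_prod_setT : tuple_prod setT = 1.
Proof. by rewrite /tuple_prod /pushforward preimage_setT probability_setT. Qed.

HB.instance Definition _ := Measure_isProbability.Build _ _ _ tuple_prod
  tuple_prod_setT.

End product_probability_step.

Fixpoint tuple_power d (T : measurableType d) (R : realType)
    (P : probability T R) (n : nat) : probability (n.-tuple T) R :=
  match n with
  | 0 => dirac [tuple]
  | m.+1 => tuple_prod P (tuple_power P m)
  end.

Section lebesgue_cube.
Local Open Scope ereal_scope.
Context (R : realType).

Definition lebesgue01 : set (measurableTypeR R) -> \bar R :=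
  mrestr lebesgue_measure (measurable_itv `[0%R, 1%R]).

HB.instance Definition _ := Measure.on lebesgue01.

Let lebesgue01_setT : lebesgue01 setT = 1.
Proof.
by rewrite /lebesgue01 /mrestr setTI lebesgue_measure_itv/= lte01 oppr0 adde0.
Qed.

HB.instance Definition _ := Measure_isProbability.Build _ _ _ lebesgue01
  lebesgue01_setT.

Definition lebesgue_cube n :
    probability (n.-tuple (measurableTypeR R)) R := tuple_power lebesgue01 n.

End lebesgue_cube.

Definition cube (R : realType) (n : nat) : set (coords R n) :=
  [set k | forall i, 0 <= (tnth k i : R) <= 1].
Arguments cube : clear implicits.

Definition tail (R : realType) (N j : nat) (k : coords R N) : coords R (N - j) :=
  [tuple of drop j k].

(* The cube is topologised as a subspace of the row vectors. *)
Definition cube_continuous (R : realType) (n M : nat)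
    (f : coords R n -> 'M[R[i]]_M) : Prop :=
  {within [set v : 'rV[R]_n | forall i, 0 <= v ord0 i <= 1],
    continuous (fun v : 'rV[R]_n =>
      (f [tuple v ord0 i | i < n] : 'M[R[i]^o]_M))}.

Section partial_integrals.
Context (R : realType).

Definition mx_integral d (T : measurableType d) (mu : {measure set T -> \bar R})
    (D : set T) (m n : nat) (F : T -> 'M[R[i]]_(m, n)) : 'M[R[i]]_(m, n) :=
  \matrix_(p, q) Complex (\int[mu]_(x in D) complex.Re (F x p q))
                         (\int[mu]_(x in D) complex.Im (F x p q)).

Context (N m n : nat).
Implicit Types (F : coords R N -> 'M[R[i]]_(m, n)) (k : coords R N).

Definition set_coord (j : nat) (x : R) k : coords R N :=
  [tuple (if i == j :> nat then x else tnth k i) | i < N].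

Definition set_prefix (j : nat) (t : coords R j) k : coords R N :=
  [tuple nth (tnth k i) t i | i < N].

(* < F >_{j + 1} *)
Definition coord_integral (j : nat) F k : 'M[R[i]]_(m, n) :=
  mx_integral lebesgue_measure `[0, 1]%classic
    (fun x : measurableTypeR R => F (set_coord j x k)).

(* < F >_{1, j} *)
Definition prefix_integral (j : nat) F k : 'M[R[i]]_(m, n) :=
  mx_integral (lebesgue_cube R j) (cube R j)
    (fun t => F (set_prefix t k)).

End partial_integrals.

(* Elements of L^2([0,1]^N, C^M) are represented by functions, two of them
   being identified when they agree almost everywhere in the cube. *)
Section L2.
Context (R : realType) (N M : nat).
Notation field := (coords R N -> 'cV[R[i]]_M).
Implicit Types (u v : field) (T B : field -> field).

Definition sqnorm u : \bar R :=
  (\int[lebesgue_cube R N]_(k in cube R N)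
     (\sum_(p < M) (complex.Re (u k p ord0) ^+ 2
                    + complex.Im (u k p ord0) ^+ 2))%:E)%E.

Definition inL2 u : Prop :=
  (forall p, measurable_fun (cube R N)
               (fun k => complex.Re (u k p ord0))
          /\ measurable_fun (cube R N)
               (fun k => complex.Im (u k p ord0)))
  /\ (sqnorm u < +oo)%E.

Definition eqL2 u v : Prop :=
  {ae lebesgue_cube R N, forall k, cube R N k -> u k = v k}.

(* Linearity and boundedness make B compatible with eqL2. *)
Definition bounded_linear B : Prop :=
  [/\ forall u, inL2 u -> inL2 (B u),
      forall (a : R[i]) u v, inL2 u -> inL2 v ->
        eqL2 (B (fun k => a *: u k + v k)) (fun k => a *: B u k + B v k)
    & exists c : R, forall u, inL2 u ->
        (sqnorm (B u) <= (c ^+ 2)%:E * sqnorm u)%E].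

Definition resolvent_set T : set R[i] :=
  [set lam | exists B, bounded_linear B /\
    forall u, inL2 u ->
      eqL2 (B (fun k => T u k - lam *: u k)) u /\
      eqL2 (fun k => T (B u) k - lam *: B u k) u].

Definition spectrum T : set R[i] := ~` resolvent_set T.

End L2.

Section continued_fractions.
Context (R : realType) (N M : nat).
Variable A : forall j : nat, coords R (N - j) -> 'M[R[i]]_M.
Arguments A : clear implicits.
Implicit Types (k : coords R N) (j : nat) (lam : R[i]).

Definition opA (u : coords R N -> 'cV[R[i]]_M) k : 'cV[R[i]]_M :=
  A 0 (tail 0 k) *m u k
  + \sum_(1 <= j < N.+1) A j (tail j k) *m prefix_integral j u k.

(* The inverse of F_j.  When S = < F_{j-1}^{-1} >_j is singular, F_j is
   infinite, but F_j^{-1} still makes sense: it is G_j^{-1} S, which for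
   invertible S is the inverse of A_j + S^{-1} = S^{-1} G_j. *)
Fixpoint cfrac_inv lam j : coords R N -> 'M[R[i]]_M :=
  match j with
  | 0 => fun k => invmx (A 0 (tail 0 k) - lam%:M)
  | i.+1 => fun k =>
      let S := coord_integral i (cfrac_inv lam i) k in
      let Aj := A i.+1 (tail i.+1 k) in
      if S \in unitmx then invmx (Aj + invmx S)
      else invmx (1%:M + S *m Aj) *m S
  end.

(* F_j; for j > 0 it is meaningful where < F_{j-1}^{-1} >_j is invertible. *)
Definition cfrac lam j k : 'M[R[i]]_M :=
  match j with
  | 0 => A 0 (tail 0 k) - lam%:M
  | i.+1 => A i.+1 (tail i.+1 k)
            + invmx (coord_integral i (cfrac_inv lam i) k)
  end.

Definition Gmx lam j k : 'M[R[i]]_M :=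
  match j with
  | 0 => cfrac lam 0 k
  | i.+1 => 1%:M + coord_integral i (cfrac_inv lam i) k
                   *m A i.+1 (tail i.+1 k)
  end.

Lemma cfrac_inv0 lam k : cfrac_inv lam 0 k = invmx (cfrac lam 0 k).
Proof. by []. Qed.

Lemma cfrac_invS lam j k :
  coord_integral j (cfrac_inv lam j) k \in unitmx ->
  cfrac_inv lam j.+1 k = invmx (cfrac lam j.+1 k).
Proof. by move=> uS /=; rewrite uS. Qed.

Lemma GmxS lam j k :
  coord_integral j (cfrac_inv lam j) k \in unitmx ->
  Gmx lam j.+1 k = coord_integral j (cfrac_inv lam j) k *m cfrac lam j.+1 k.
Proof. by move=> uS; rewrite /= mulmxDr mulmxV// addrC. Qed.

Lemma cfrac_invE lam j k : Gmx lam j.+1 k \in unitmx ->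
  cfrac_inv lam j.+1 k
  = invmx (Gmx lam j.+1 k) *m coord_integral j (cfrac_inv lam j) k.
Proof.
move=> uG.
have [uS|nuS] := boolP (coord_integral j (cfrac_inv lam j) k \in unitmx).
  rewrite cfrac_invS// GmxS//; move: uG; rewrite GmxS// unitmx_mul => /andP[_ uF].
  set S := coord_integral _ _ _ in uS uF *; set F := cfrac _ _ _ in uF *.
  have uSF : S *m F \in unitmx by rewrite unitmx_mul uS.
  by rewrite -[LHS]mul1mx -(mulVmx uSF) -!mulmxA mulmxV// mulmx1.
by rewrite /= (negbTE nuS).
Qed.

Definition zeros j : set R[i] :=
  [set lam | exists2 k, cube R N k & \det (Gmx lam j k) = 0].

(* sigma_0, ..., sigma_{j-1} together. *)
Fixpoint sigma_below j : set R[i] :=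
  match j with
  | 0 => set0
  | i.+1 => sigma_below i `|` (zeros i `\` sigma_below i)
  end.

Definition sigma j : set R[i] := zeros j `\` sigma_below j.

Lemma sigma_belowE j : sigma_below j = \bigcup_(i in `I_j) sigma i.
Proof.
elim: j => [|j IHj]; first by rewrite II0 bigcup_set0.
by rewrite /= IIS bigcup_setU bigcup_set1 -IHj.
Qed.

End continued_fractions.

(* Main.v *)
(* Write T_j for the operator A_0 - lam + A_1 <.>_1 + ... + A_j <.>_{1,j}, so that
   T_N is the operator A - lam, and set X_j = X_{j-1} (1 - A_j F_j^-1), X_0 = F_0^-1.
   As long as G_0, ..., G_j are invertible on the cube, the X_j are continuous,
   <X_j>_{1,j} = F_j^-1, <X_j>_{1,j+1} = <F_j^-1>_{j+1}, and T_j (X_j w) = w for every w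
   depending on k_j only.  Solving T_{j+1} u = f for <u>_{1,j+1} then gives
     T_{j+1}^-1 f = T_j^-1 f - X_j A_{j+1} G_{j+1}^-1 <T_j^-1 f>_{1,j+1},
   so lam is in the resolvent set when no G_j is singular.

   Conversely let j be minimal such that G_j v = 0 at some point kappa, with v <> 0, and put
   u = X_{j-1} A_j v phi (u = v phi if j = 0), phi being the indicator of a small box around
   kappa in the variables k_{j+1}, ..., k_N.  Then T_j u = A_j G_j v phi (G_0 v phi if j = 0)
   is small while <u>_{1,j} = (G_j v - v) phi is not, and the remaining terms A_n <u>_{1,n},
   n > j, are small by Cauchy-Schwarz because they average the thin support of u over
   k_{j+1}.  Hence T_N is not bounded below. *)
From HB Require Import structures.
Require Import Defs.
From mathcomp Require Import all_boot all_order all_algebra.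
From mathcomp Require Import all_classical all_reals all_analysis.
From mathcomp Require Import measurable_realfun complex.
From mathcomp Require Import ring lra zify.

Set Implicit Arguments.
Unset Strict Implicit.
Unset Printing Implicit Defensive.
Import Order.TTheory GRing.Theory Num.Theory.
Import numFieldNormedType.Exports.
Local Open Scope classical_set_scope.
Local Open Scope ring_scope.

(** * Lebesgue measure on the cube *)

(** $\mathbf F_j$ itself can be infinite, so every identity is stated for $F_j^{-1}=G_j^{-1}S_j$
    with $S_j=\langle F_{j-1}^{-1}\rangle_j$; this is continuous as soon as $G_0,\dots,G_j$ are
    invertible, whether or not $S_j$ is. The recursion closes because a function of $k_j$ alone is
    constant for $\langle\cdot\rangle_{1,j}$ and can be pulled out on the right. This is why $X_j$
    multiplies from the left, and why the cut-off $\phi$ leaves $k_1,\dots,k_j$ free: it then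
    commutes with $T_j$. No norm of the approximate eigenfunction is computed:
    $\langle\cdot\rangle_{1,j}$ is a contraction, so $u$ is at least as large as its average, and
    $T_ju$ is small relative to that average because both are $\phi$ times continuous functions, one
    vanishing at $\kappa$ and the other not. Identities between the continuous matrices hold at
    every point of the cube; those for elements of $L^2$ hold only almost everywhere, since a
    square-integrable function is known to be integrable only along almost every fibre. *)

Section boxes.
Context (R : realType).
Local Open Scope ereal_scope.

Definition box n (B : 'I_n -> set (measurableTypeR R)) : set (coords R n) :=
  [set k | forall i, B i (tnth k i)].

Lemma measurable_box n (B : 'I_n -> set (measurableTypeR R)) :
  (forall i, measurable (B i)) -> measurable (box B).
Proof.
move=> mB.
rewrite (_ : box B = \bigcap_(i in [set: 'I_n]) (@tnth _ _ ^~ i @^-1` B i)); last first.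
  by apply/seteqP; split => k /= kB i; [move=> _|]; exact: kB.
apply: fin_bigcap_measurable => // i _.
by rewrite -[X in measurable X]setTI; exact: measurable_tnth.
Qed.

Lemma box_lebesgue_cube n (B : 'I_n -> set (measurableTypeR R)) :
  (forall i, measurable (B i)) ->
  lebesgue_cube R n (box B) = \prod_(i < n) lebesgue01 (B i).
Proof.
elim: n B => [|n IHn] B mB.
  rewrite big_ord0 /lebesgue_cube /= diracE mem_set//.
  by case.
rewrite big_ord_recl -IHn// /lebesgue_cube /= /tuple_prod /pushforward.
rewrite -product_measure1E//; last exact: measurable_box.
congr (_ _); apply/seteqP; split => -[x t] /=.
  move=> xtB; split => /=; first exact: (xtB ord0).
  by move=> i; have := xtB (lift ord0 i); rewrite tnthS.
move=> [/= Bx Bt] i; have [i' ->|->//] := unliftP ord0 i.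
by rewrite tnthS; exact: Bt.
Qed.

(** Boxes are stable under intersection and generate the product sigma-algebra, and the whole space
    is a box of mass 1, so a measure is determined by its values on boxes. *)
Lemma lebesgue_cube_unique n (mu : {measure set (coords R n) -> \bar R}) :
  (forall B, (forall i, measurable (B i)) ->
     mu (box B) = \prod_(i < n) lebesgue01 (B i)) ->
  forall X, measurable X -> mu X = lebesgue_cube R n X.
Proof.
move=> muB X mX.
pose C : set (set (coords R n)) :=
  [set box B | B in [set B | forall i, measurable (B i)]].
have boxT : box (fun=> setT) = setT :> set (coords R n).
  by apply/seteqP; split.
apply: (measure_unique C (fun=> setT)) => //.
- rewrite /measurable/= /g_sigma_preimage; apply/seteqP; split.
    apply: smallest_sub; first exact: smallest_sigma_algebra.
    rewrite -bigcup_seq; apply: bigcup_sub => i _ _ [Y mY <-].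
    apply: sub_sigma_algebra; exists (fun j => if j == i then Y else setT).
      by move=> j /=; case: ifP.
    rewrite setTI; apply/seteqP; split => k /=; first by move/(_ i); rewrite eqxx.
    by move=> Yk j; case: eqP => // ->.
  apply: smallest_sub; first exact: sigma_algebra_measurable.
  by move=> _ [B mB <-]; exact: measurable_box.
- move=> _ _ [B mB <-] [B' mB' <-].
  exists (fun i => B i `&` B' i); first by move=> i; exact: measurableI.
  apply/seteqP; split => k /=; first by move=> BB; split => i; case: (BB i).
  by move=> [Bk B'k] i; split.
- by move=> _; exists (fun=> setT).
- by rewrite bigcup_const//; exists 0%N.
- by move=> _ [B mB <-]; rewrite muB//= box_lebesgue_cube.
- move=> _; rewrite -boxT muB//.
  by rewrite big1 ?ltry// => i _; exact: probability_setT.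
Qed.

End boxes.

(** * Images of product measures that are again Lebesgue measure on the cube *)

Section cube_pushforward.
Context (R : realType).
Local Open Scope ereal_scope.

Lemma pushforward_lebesgue_cube d (T : measurableType d) n
    (mu : {measure set T -> \bar R}) (f : T -> coords R n) :
  measurable_fun setT f ->
  (forall B, (forall i, measurable (B i)) ->
     mu (f @^-1` box B) = \prod_(i < n) lebesgue01 (B i)) ->
  forall X, measurable X -> pushforward mu f X = lebesgue_cube R n X.
Proof.
move=> mf muB X mX.
pose pm : {measure set (coords R n) -> \bar R} :=
  measure_function_pushforward__canonical__measure_function_Measure mu mf.
exact: (@lebesgue_cube_unique _ _ pm).
Qed.

Lemma ge0_integral_lebesgue_cube d (T : measurableType d) n
    (mu : {measure set T -> \bar R}) (f : T -> coords R n) :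
  measurable_fun setT f ->
  (forall X, measurable X -> pushforward mu f X = lebesgue_cube R n X) ->
  forall g : coords R n -> \bar R, measurable_fun [set: coords R n] g ->
  (forall k, 0 <= g k) ->
  \int[lebesgue_cube R n]_k g k = \int[mu]_x g (f x).
Proof.
move=> mf muf g mg g0.
pose pm : {measure set (coords R n) -> \bar R} :=
  measure_function_pushforward__canonical__measure_function_Measure mu mf.
rewrite (@eq_measure_integral _ _ _ _ pm); last first.
  by move=> A mA _; exact/esym/muf.
by rewrite ge0_integral_pushforward// preimage_setT.
Qed.

Section set_prefix.
Context (j N : nat).
Implicit Types (t : coords R j) (k : coords R N).

Lemma tnth_set_prefixl t k (i : 'I_N) (ij : (i < j)%N) :
  tnth (set_prefix t k) i = tnth t (Ordinal ij).
Proof. by rewrite tnth_mktuple [RHS](tnth_nth (tnth k i)). Qed.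

Lemma tnth_set_prefixr t k (i : 'I_N) :
  (j <= i)%N -> tnth (set_prefix t k) i = tnth k i.
Proof. by move=> ji; rewrite tnth_mktuple nth_default// size_tuple. Qed.

Lemma measurable_set_prefix :
  measurable_fun setT (fun p : coords R j * coords R N => set_prefix p.1 p.2).
Proof.
apply/measurable_fun_tnthP => i.
have [ij|ji] := ltnP i j.
  rewrite (_ : _ \o _ = (fun t => tnth t (Ordinal ij)) \o fst); last first.
    by apply/funext => p /=; rewrite (tnth_set_prefixl _ _ ij).
  by apply: measurableT_comp => //; exact: measurable_tnth.
rewrite (_ : _ \o _ = (fun k => tnth k i) \o snd); last first.
  by apply/funext => p /=; rewrite tnth_set_prefixr.
by apply: measurableT_comp => //; exact: measurable_tnth.
Qed.

(** Overwriting the first [j] coordinates of a uniform point by an independent uniform [j]-tuple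
    leaves it uniform. Fubini for the averages over the first [j] variables is thus available
    without splitting an [N]-tuple into two pieces. *)
Lemma pushforward_set_prefix (jN : (j <= N)%N) X : measurable X ->
  pushforward (lebesgue_cube R j \x lebesgue_cube R N)
    (fun p => set_prefix p.1 p.2) X = lebesgue_cube R N X.
Proof.
apply: pushforward_lebesgue_cube; first exact: measurable_set_prefix.
move=> B mB.
pose B1 (i : 'I_j) := B (widen_ord jN i).
(* The overwritten coordinates of [k] are unconstrained; each contributes a factor 1 to the
   product. *)
pose B2 (i : 'I_N) := if (i < j)%N then setT else B i.
have mB2 i : measurable (B2 i) by rewrite /B2; case: ifP.
rewrite (_ : _ @^-1` _ = box B1 `*` box B2); last first.
  apply/seteqP; split => -[t k] /= Bt.
    split => i.
      have ij : (widen_ord jN i < j)%N by exact: (ltn_ord i).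
      have := Bt (widen_ord jN i); rewrite (tnth_set_prefixl _ _ ij).
      by rewrite (_ : Ordinal ij = i)//; exact/val_inj.
    rewrite /B2; case: ltnP => // ji.
    by have := Bt i; rewrite tnth_set_prefixr.
  case: Bt => Bt Bk i; have [ij|ji] := ltnP i j.
    rewrite (tnth_set_prefixl _ _ ij); have := Bt (Ordinal ij).
    by rewrite /B1 (_ : widen_ord jN (Ordinal ij) = i)//; exact/val_inj.
  by have := Bk i; rewrite tnth_set_prefixr// /B2 ltnNge ji.
transitivity (lebesgue_cube R j (box B1) * lebesgue_cube R N (box B2)).
  by apply: product_measure1E; apply: measurable_box => // i; exact: mB.
rewrite (box_lebesgue_cube mB2) (@box_lebesgue_cube _ _ B1)//; last first.
  by move=> i; exact: mB.
rewrite [RHS](bigID (fun i : 'I_N => (i < j)%N))/=.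
rewrite (big_ord_narrow jN); congr (_ * _).
rewrite [LHS](bigID (fun i : 'I_N => (i < j)%N))/= big1 ?mul1e.
  by apply: eq_bigr => i ij; rewrite /B2 (negbTE ij).
by move=> i ij; rewrite /B2 ij; exact: probability_setT.
Qed.

End set_prefix.

Section rcons.
Context (n : nat).

(** [lebesgue_cube] is built by adding a first coordinate, whereas passing from [j] to [j + 1]
    averaged variables adds a last one. *)
Definition tuple_rcons (p : coords R n * measurableTypeR R) : coords R n.+1 :=
  [tuple of rcons p.1 p.2].

Lemma tnth_tuple_rcons p (i : 'I_n.+1) :
  tnth (tuple_rcons p) i = if unlift ord_max i is Some i' then tnth p.1 i' else p.2.
Proof.
case: p => s x; rewrite (tnth_nth x) nth_rcons size_tuple /=.
case: unliftP => [i' ->|->/=]; last by rewrite ltnn eqxx.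
by rewrite lift_max ltn_ord -tnth_nth.
Qed.

Lemma measurable_tuple_rcons : measurable_fun setT tuple_rcons.
Proof.
apply/measurable_fun_tnthP => i.
under [_ \o _]funext do rewrite /= tnth_tuple_rcons.
case: unliftP => [i' _|_]; last exact: measurable_snd.
by apply: (measurableT_comp (measurable_tnth i')).
Qed.

Lemma pushforward_tuple_rcons X : measurable X ->
  pushforward (lebesgue_cube R n \x @lebesgue01 R) tuple_rcons X
  = lebesgue_cube R n.+1 X.
Proof.
apply: pushforward_lebesgue_cube; first exact: measurable_tuple_rcons.
move=> B mB.
rewrite (_ : _ @^-1` _ = box (fun i => B (lift ord_max i)) `*` B ord_max); last first.
  apply/seteqP; split => -[t k] /= Bt.
    split=> [i|]; last by have := Bt ord_max; rewrite tnth_tuple_rcons unlift_none.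
    by have := Bt (lift ord_max i); rewrite tnth_tuple_rcons liftK.
  case: Bt => Bt Bk i; rewrite tnth_tuple_rcons.
  by case: unliftP => [i' ->|->] /=.
transitivity (lebesgue_cube R n (box (fun i => B (lift ord_max i)))
              * lebesgue01 (B ord_max)).
  by apply: product_measure1E => //; exact: measurable_box.
rewrite box_lebesgue_cube// big_ord_recr/=; congr (_ * _).
by apply: eq_bigr => i _; congr (lebesgue01 (B _)); apply: ord_inj; rewrite lift_max.
Qed.

End rcons.

End cube_pushforward.

(** * Square-integrable functions on a probability space *)

Section square_integrals.
Context (R : realType).
Local Open Scope ereal_scope.

(** On a probability space $|g|\le 1+g^2$ suffices. *)
Lemma integrable_sqr d (T : measurableType d) (P : probability T R) (g : T -> R) :
  measurable_fun setT g -> \int[P]_x ((g x) ^+ 2)%:E < +oo ->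
  P.-integrable setT (EFin \o g).
Proof.
move=> mg g2.
apply/integrableP; split; first exact/measurable_EFinP.
have mg2 : measurable_fun setT (fun x => ((g x) ^+ 2)%:E).
  by apply/measurable_EFinP; exact: measurable_funX.
apply: (@le_lt_trans _ _ (\int[P]_x (1 + ((g x) ^+ 2)%:E))).
  apply: ge0_le_integral => //.
  - by apply: measurableT_comp => //; exact/measurable_EFinP.
  - by apply: emeasurable_funD => //; exact: measurable_cst.
  - move=> x _ /=; rewrite -EFinD lee_fin.
    have := sqr_ge0 (`|g x| - 1)%R; rewrite -[((g x) ^+ 2)%R]real_normK ?num_real//.
    by have := sqr_ge0 `|g x|%R; nra.
rewrite ge0_integralD//; last by move=> x _; rewrite lee_fin sqr_ge0.
by rewrite integral_cst// mul1e lte_add_pinfty// (le_lt_trans (probability_le1 _ _))// ltry.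
Qed.

(* Integrate [2 s g <= g^2 + s^2 1_A] with [s = (int g) / c]. *)
Lemma sqr_Rintegral_le d (T : measurableType d) (P : probability T R)
    (A : set T) (c : R) (g : T -> R) :
  measurable A -> (0 < c)%R -> P A <= c%:E ->
  measurable_fun setT g -> (forall x, ~ A x -> g x = 0%R) ->
  ((\int[P]_x g x)%R ^+ 2)%:E <= c%:E * \int[P]_x ((g x) ^+ 2)%:E.
Proof.
move=> mA c0 PA mg gA.
have mg2 : measurable_fun setT (fun x => ((g x) ^+ 2)%:E).
  by apply/measurable_EFinP; exact: measurable_funX.
have g20 : 0 <= \int[P]_x ((g x) ^+ 2)%:E.
  by apply: integral_ge0 => x _; rewrite lee_fin sqr_ge0.
have [g2|] := ltP (\int[P]_x ((g x) ^+ 2)%:E) +oo; last first.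
  by rewrite leye_eq => /eqP ->; rewrite gt0_muley ?leey.
have ig := integrable_sqr mg g2.
set m := (\int[P]_x g x)%R.
have mE : \int[P]_x (g x)%:E = m%:E.
  by rewrite /m /Rintegral fineK//; exact: integrable_fin_num.
have ig2 : P.-integrable setT (fun x => ((g x) ^+ 2)%:E).
  apply/integrableP; split => //.
  rewrite (eq_integral (fun x => ((g x) ^+ 2)%:E))// => x _.
  by rewrite gee0_abs// lee_fin sqr_ge0.
pose s := (m / c)%R.
have iA : P.-integrable setT (EFin \o \1_A) by exact: integrable_indic.
have : \int[P]_x ((2 * s)%:E * (g x)%:E) <=
       \int[P]_x (((g x) ^+ 2)%:E + (s ^+ 2)%:E * (\1_A x)%:E).
  apply: le_integral => //.
  - exact: integrableZl.
  - by apply: integrableD => //; exact: integrableZl.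
  - move=> x _; rewrite -!EFinM -EFinD lee_fin indicE.
    have [xA|xA] := boolP (x \in A); first by rewrite mulr1; have := sqr_ge0 (g x - s)%R; nra.
    by rewrite gA ?mulr0 ?expr0n ?addr0// => /mem_set; apply/negP.
rewrite integralZl// mE integralD//; last exact: integrableZl.
rewrite integralZl//.
rewrite integral_indic// setIT.
have [q qE] : exists q : R, \int[P]_x ((g x) ^+ 2)%:E = q%:E.
  exists (fine (\int[P]_x ((g x) ^+ 2)%:E)); rewrite fineK//.
  exact: (integrable_fin_num _ ig2).
rewrite qE in g20 *; have [a aE] : exists a : R, P A = a%:E.
  by exists (fine (P A)); rewrite fineK// fin_num_measure.
rewrite aE in PA *; rewrite lee_fin in PA.
rewrite (_ : (s ^+ 2)%:E * _ = (s ^+ 2)%:E * a%:E); last by congr (_ * _).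
rewrite -!EFinM -!EFinD !lee_fin.
have sE : m = (s * c)%R by rewrite /s mulfVK// gt_eqF.
rewrite sE => H.
have : (s * (s * c) <= q)%R by have := sqr_ge0 s; nra.
nra.
Qed.

End square_integrals.

Section partial_integral.
Context (R : realType) (j N : nat) (jN : (j <= N)%N).
Local Open Scope ereal_scope.
Implicit Types f : coords R N -> R.

Let measurable_sp d (T : measurableType d) (f : coords R N -> T) :
  measurable_fun setT f ->
  measurable_fun setT (fun p : coords R j * coords R N => f (set_prefix p.1 p.2)).
Proof. by move=> mf; apply: (measurableT_comp mf); exact: measurable_set_prefix. Qed.

Let measurable_sp1 d (T : measurableType d) (f : coords R N -> T) k :
  measurable_fun setT f ->
  measurable_fun setT (fun t : coords R j => f (set_prefix t k)).
Proof.
move=> mf; rewrite (_ : (fun t => _) = (fun p => f (set_prefix p.1 p.2))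
  \o (fun t : coords R j => (t, k)))//.
by apply: measurableT_comp; [exact: measurable_sp|exact: measurable_pair2].
Qed.

Let measurable_ge0 (g : coords R N -> \bar R) :
  measurable_fun setT g -> (forall k, 0 <= g k) ->
  measurable_fun setT (fun k => \int[lebesgue_cube R j]_t g (set_prefix t k)).
Proof.
move=> mg g0.
exact: (@measurable_fun_fubini_tonelli_G _ _ _ _ _ (lebesgue_cube R j)
  (fun p => g (set_prefix p.1 p.2)) (measurable_sp mg)).
Qed.

(** Positive and negative parts are treated separately, so that Tonelli gives measurability with no
    integrability assumption on the fibres. *)
Lemma measurable_partial_integral f : measurable_fun setT f ->
  measurable_fun setT (fun k => \int[lebesgue_cube R j]_t f (set_prefix t k))%R.
Proof.
move=> mf; rewrite /Rintegral.
apply: (measurableT_comp (f := fine)) => //.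
under eq_fun do rewrite integralE.
apply: emeasurable_funB.
  have mf' : measurable_fun setT (EFin \o f)^\+.
    by apply: measurable_funepos; exact/measurable_EFinP.
  apply: eq_measurable_fun (measurable_ge0 mf' (fun k => funepos_ge0 _ k)).
  by move=> k _; apply: eq_integral => t _; rewrite !funeposE.
have mf' : measurable_fun setT (EFin \o f)^\-.
  by apply: measurable_funeneg; exact/measurable_EFinP.
apply: eq_measurable_fun (measurable_ge0 mf' (fun k => funeneg_ge0 _ k)).
by move=> k _; apply: eq_integral => t _; rewrite !funenegE.
Qed.

Lemma ge0_integral_set_prefix (g : coords R N -> \bar R) :
  measurable_fun setT g -> (forall k, 0 <= g k) ->
  \int[lebesgue_cube R N]_k \int[lebesgue_cube R j]_t g (set_prefix t k)
  = \int[lebesgue_cube R N]_k g k.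
Proof.
move=> mg g0.
rewrite [RHS](ge0_integral_lebesgue_cube (@measurable_set_prefix R j N)
           (pushforward_set_prefix jN))//.
exact/esym/(@fubini_tonelli2 _ _ _ _ _ (lebesgue_cube R j) (lebesgue_cube R N)
  (fun p => g (set_prefix p.1 p.2)) (measurable_sp mg)).
Qed.

Lemma ae_integrable_section f : (lebesgue_cube R N).-integrable setT (EFin \o f) ->
  {ae lebesgue_cube R N, forall k, (lebesgue_cube R j).-integrable setT
     (fun t => (f (set_prefix t k))%:E)}.
Proof.
move=> /integrableP[mf f1].
have mf' := measurable_sp mf.
apply: (@ae_integrable2 _ _ _ _ _ (lebesgue_cube R j) (lebesgue_cube R N)
  (fun p => (f (set_prefix p.1 p.2))%:E)).
apply/integrable21ltyP => //.
apply: le_lt_trans f1.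
rewrite (ge0_integral_set_prefix (g := fun k => `|(f k)%:E|))//.
exact: measurableT_comp.
Qed.

(** Cauchy-Schwarz on each fibre gains the measure of the part of the fibre that meets the support.
    With [A] the whole space this makes averaging a contraction; with [A] a thin slab it makes the
    average small. *)
Lemma partial_integral_sqr_le (A : set (coords R N)) (c : R) f :
  measurable A -> (0 < c)%R ->
  (forall k, lebesgue_cube R j [set t | A (set_prefix t k)] <= c%:E) ->
  measurable_fun setT f -> (forall k, ~ A k -> f k = 0%R) ->
  \int[lebesgue_cube R N]_k
     ((\int[lebesgue_cube R j]_t f (set_prefix t k))%R ^+ 2)%:E
  <= c%:E * \int[lebesgue_cube R N]_k ((f k) ^+ 2)%:E.
Proof.
move=> mA c0 Ac mf fA.
have mf2 : measurable_fun setT (fun k => ((f k) ^+ 2)%:E).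
  by apply/measurable_EFinP; exact: measurable_funX.
rewrite -(ge0_integral_set_prefix mf2); last by move=> k; rewrite lee_fin sqr_ge0.
rewrite -ge0_integralZl//; last 3 first.
- by apply: (measurable_ge0 mf2) => k; rewrite lee_fin sqr_ge0.
- by move=> k _; apply: integral_ge0 => t _; rewrite lee_fin sqr_ge0.
- by rewrite lee_fin ltW.
apply: ge0_le_integral => //.
- by move=> k _; rewrite lee_fin sqr_ge0.
- apply/measurable_EFinP/measurable_funX; exact: measurable_partial_integral.
- apply: emeasurable_funM; first exact: measurable_cst.
  by apply: (measurable_ge0 mf2) => k; rewrite lee_fin sqr_ge0.
move=> k _; apply: (sqr_Rintegral_le (A := [set t | A (set_prefix t k)])) => //.
- rewrite -[X in measurable X]setTI.
  have : measurable_fun setT (fun t : coords R j => set_prefix t k).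
    exact: (measurable_sp1 (f := id)).
  by apply.
- exact: measurable_sp1.
- by move=> t nA; rewrite fA.
Qed.

End partial_integral.

(** * Continuous matrix functions on the cube *)

Section clamp.
Context (R : realType).

Definition clamp (x : R) : R := Num.max 0 (Num.min x 1).

Lemma clamp_itv x : 0 <= clamp x <= 1.
Proof.
by rewrite le_max lexx/= ge_max ler01/= ge_min lexx orbT.
Qed.

Lemma clamp_id x : 0 <= x <= 1 -> clamp x = x.
Proof. by move=> /andP[x0 x1]; rewrite /clamp min_l// max_r. Qed.

Lemma continuous_clamp : continuous clamp.
Proof.
move=> x.
have cst_cont (c : R) : {for x, continuous (cst c : R -> R^o)} by exact: cvg_cst.
have min_cont : {for x, continuous ((id : R -> R^o) \min cst 1)}.
  by apply: continuous_min => //; exact: cvg_id.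
exact: (continuous_max (cst_cont 0) min_cont).
Qed.

Definition row_cube n (v : 'rV[R]_n) : coords R n :=
  [tuple clamp (v ord0 i) | i < n].

Lemma row_cubeP n (v : 'rV[R]_n) : cube R n (row_cube v).
Proof. by move=> i; rewrite tnth_mktuple; exact: clamp_itv. Qed.

Definition row_of n (k : coords R n) : 'rV[R]_n := \row_i tnth k i.

Lemma row_ofK n (k : coords R n) : cube R n k -> row_cube (row_of k) = k.
Proof.
move=> kc; apply: eq_from_tnth => i.
by rewrite tnth_mktuple mxE clamp_id//; exact: kc.
Qed.

End clamp.

Lemma continuous_matrix (T U : topologicalType) m n (f : T -> 'M[U]_(m, n)) :
  (forall i j, continuous (fun x => f x i j)) -> continuous f.
Proof.
move=> fc x A [P Px PA]; rewrite nbhs_simpl /=.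
have : \forall y \near x, forall i j, P i j (f y i j).
  apply: filter_forall => i; apply: filter_forall => j.
  exact: (fc i j x _ (Px i j)).
by apply: filterS => y Py; exact: PA.
Qed.

Section cube_continuity.
Context (R : realType).
Implicit Types n : nat.

(** Continuity on the cube, expressed through the retraction [row_cube] of the whole row space onto
    it. Only the values of [f] on the cube matter, yet no subspace topology appears and the usual
    rules for continuous functions apply. *)
Definition rcont n (f : coords R n -> R) : Prop :=
  continuous (fun v : 'rV[R]_n => f (row_cube v)).

Definition ccont n (f : coords R n -> R[i]) : Prop :=
  rcont (fun k => complex.Re (f k)) /\ rcont (fun k => complex.Im (f k)).

Definition mcont n p q (F : coords R n -> 'M[R[i]]_(p, q)) : Prop :=
  forall i j, ccont (fun k => F k i j).

Lemma eq_ccont n (f g : coords R n -> R[i]) :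
  (forall k, cube R n k -> f k = g k) -> ccont f -> ccont g.
Proof.
move=> fg [f1 f2]; split.
  rewrite /rcont (_ : (fun v => _) = (fun v => complex.Re (f (row_cube v))))//.
  by apply/funext => v; rewrite fg//; exact: row_cubeP.
rewrite /rcont (_ : (fun v => _) = (fun v => complex.Im (f (row_cube v))))//.
by apply/funext => v; rewrite fg//; exact: row_cubeP.
Qed.

Lemma ccont_cst n (c : R[i]) : ccont (fun _ : coords R n => c).
Proof. by split => v; apply: (@cst_continuous _ _ _). Qed.

Lemma rcontD n (f g : coords R n -> R) :
  rcont f -> rcont g -> rcont (fun k => f k + g k).
Proof. by move=> fc gc v; exact: (cvgD (fc v) (gc v)). Qed.

Lemma rcontN n (f : coords R n -> R) : rcont f -> rcont (fun k => - f k).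
Proof. by move=> fc v; exact: (cvgN (fc v)). Qed.

Lemma rcontM n (f g : coords R n -> R) :
  rcont f -> rcont g -> rcont (fun k => f k * g k).
Proof. by move=> fc gc v; exact: (cvgM (fc v) (gc v)). Qed.

Lemma rcontV n (f : coords R n -> R) : (forall k, cube R n k -> f k != 0) ->
  rcont f -> rcont (fun k => (f k)^-1).
Proof. by move=> f0 fc v; exact: (cvgV (f0 _ (row_cubeP v)) (fc v)). Qed.

Lemma ccontD n (f g : coords R n -> R[i]) :
  ccont f -> ccont g -> ccont (fun k => f k + g k).
Proof.
move=> [f1 f2] [g1 g2]; split.
  under eq_fun do rewrite raddfD/=.
  exact: (rcontD f1 g1).
under eq_fun do rewrite raddfD/=.
exact: (rcontD f2 g2).
Qed.

Lemma Re_mulc (x y : R[i]) : complex.Re (x * y) =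
  complex.Re x * complex.Re y - complex.Im x * complex.Im y.
Proof. by case: x => a b; case: y => c d. Qed.

Lemma Im_mulc (x y : R[i]) : complex.Im (x * y) =
  complex.Re x * complex.Im y + complex.Im x * complex.Re y.
Proof. by case: x => a b; case: y => c d. Qed.

Lemma ccontM n (f g : coords R n -> R[i]) :
  ccont f -> ccont g -> ccont (fun k => f k * g k).
Proof.
move=> [f1 f2] [g1 g2]; split.
  under eq_fun do rewrite Re_mulc/=.
  exact: (rcontD (rcontM f1 g1) (rcontN (rcontM f2 g2))).
under eq_fun do rewrite Im_mulc/=.
exact: (rcontD (rcontM f1 g2) (rcontM f2 g1)).
Qed.

Lemma ccontV n (f : coords R n -> R[i]) :
  (forall k, cube R n k -> f k != 0) -> ccont f -> ccont (fun k => (f k)^-1).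
Proof.
move=> f0 [f1 f2].
have VE (z : R[i]) : z^-1 = Complex
   (complex.Re z * (complex.Re z * complex.Re z + complex.Im z * complex.Im z)^-1)
   (- (complex.Im z * (complex.Re z * complex.Re z + complex.Im z * complex.Im z)^-1)).
  by case: z.
have Dc : rcont (fun k => (complex.Re (f k) * complex.Re (f k)
                           + complex.Im (f k) * complex.Im (f k))^-1).
  apply: rcontV; last exact: (rcontD (rcontM f1 f1) (rcontM f2 f2)).
  move=> k /f0; apply: contraNneq => /eqP.
  rewrite paddr_eq0 -?expr2 ?sqr_ge0// !sqrf_eq0 => /andP[/eqP a /eqP b].
  by apply/eqP; move: a b; case: (f _) => a b /= -> ->.
split.
  under eq_fun do rewrite VE/=.
  exact: (rcontM f1 Dc).
under eq_fun do rewrite VE/=.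
exact: (rcontN (rcontM f2 Dc)).
Qed.

Lemma ccont_sum n (I : Type) (r : seq I) (P : pred I) (f : I -> coords R n -> R[i]) :
  (forall i, P i -> ccont (f i)) -> ccont (fun k => \sum_(i <- r | P i) f i k).
Proof.
move=> fc; elim: r => [|i r IHr].
  by under eq_fun do rewrite big_nil; exact: ccont_cst.
under eq_fun do rewrite big_cons.
by case Pi : (P i) => //; apply: ccontD => //; exact: fc.
Qed.

Lemma ccont_prod n (I : Type) (r : seq I) (P : pred I) (f : I -> coords R n -> R[i]) :
  (forall i, P i -> ccont (f i)) -> ccont (fun k => \prod_(i <- r | P i) f i k).
Proof.
move=> fc; elim: r => [|i r IHr].
  by under eq_fun do rewrite big_nil; exact: ccont_cst.
under eq_fun do rewrite big_cons.
by case Pi : (P i) => //; apply: ccontM => //; exact: fc.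
Qed.

Lemma eq_mcont n p q (F F' : coords R n -> 'M[R[i]]_(p, q)) :
  (forall k, cube R n k -> F k = F' k) -> mcont F -> mcont F'.
Proof.
move=> FF Fc a b; apply: (eq_ccont _ (Fc a b)) => k kc.
by rewrite FF.
Qed.


Lemma mcont_cst n p q (C : 'M[R[i]]_(p, q)) : mcont (fun _ : coords R n => C).
Proof. by move=> i j; exact: ccont_cst. Qed.

Lemma mcontD n p q (F G : coords R n -> 'M[R[i]]_(p, q)) :
  mcont F -> mcont G -> mcont (fun k => F k + G k).
Proof. by move=> Fc Gc i j; under eq_fun do rewrite mxE; exact: ccontD. Qed.

Lemma mcontN n p q (F : coords R n -> 'M[R[i]]_(p, q)) :
  mcont F -> mcont (fun k => - F k).
Proof.
move=> Fc i j; under eq_fun do rewrite mxE -mulN1r.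
by apply: ccontM => //; exact: ccont_cst.
Qed.

Lemma mcontM n p q r (F : coords R n -> 'M[R[i]]_(p, q))
    (G : coords R n -> 'M[R[i]]_(q, r)) :
  mcont F -> mcont G -> mcont (fun k => F k *m G k).
Proof.
move=> Fc Gc i j; under eq_fun do rewrite mxE.
by apply: ccont_sum => l _; exact: ccontM.
Qed.

Lemma ccont_det n p (F : coords R n -> 'M[R[i]]_p) :
  mcont F -> ccont (fun k => \det (F k)).
Proof.
move=> Fc; rewrite /determinant; apply: ccont_sum => s _.
by apply: ccontM; [exact: ccont_cst|apply: ccont_prod => i _; exact: Fc].
Qed.

(** Cramer's rule: each entry of the inverse is a cofactor divided by the determinant, which does
    not vanish on the cube. *)
Lemma mcont_invmx n p (F : coords R n -> 'M[R[i]]_p) :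
  (forall k, cube R n k -> F k \in unitmx) -> mcont F ->
  mcont (fun k => invmx (F k)).
Proof.
move=> Fu Fc i j.
apply: (eq_ccont (f := fun k => (\det (F k))^-1 * cofactor (F k) j i)).
  by move=> k kc; rewrite /invmx Fu// !mxE.
apply: ccontM.
  apply: ccontV; last exact: ccont_det.
  by move=> k /Fu; rewrite unitmxE unitfE.
rewrite /cofactor; apply: ccontM; first exact: ccont_cst.
by apply: ccont_det => a b; under eq_fun do rewrite !mxE; exact: Fc.
Qed.

Let near_dist (z : R[i]^o) (e : R) : 0 < e ->
  \forall w \near z, `|z - w| < e%:C%C.
Proof.
move=> e0; have e0' : 0 < e%:C%C :> R[i] by rewrite ltcR.
have zz : (fun w : R[i]^o => w) w @[w --> z] --> z by exact: cvg_id.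
exact: ((cvgrPdist_lt _ _).1 zz _ e0').
Qed.

Lemma continuous_Re : continuous (@complex.Re R : R[i]^o -> R).
Proof.
move=> z; apply/(@cvgrPdist_lt _ _ _ _ (nbhs_filter (z : R[i]^o))) => e.
move=> /(near_dist z); apply: filterS => w zw.
by rewrite -raddfB /= -ltcR; exact: (le_lt_trans (normc_ge_Re _)).
Qed.

Lemma continuous_Im : continuous (@complex.Im R : R[i]^o -> R).
Proof.
move=> z; apply/(@cvgrPdist_lt _ _ _ _ (nbhs_filter (z : R[i]^o))) => e.
move=> /(near_dist z); apply: filterS => w zw.
(* Up to sign the imaginary part of $z$ is the real part of $zi$, and $|zi|=|z|$, so the bound for
   real parts applies. *)
rewrite -raddfB /= -normrN -ReiNIm -ltcR; apply: (le_lt_trans (normc_ge_Re _)).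
by rewrite normrM [X in _ * X]normc_def/= expr0n expr1n add0r sqrtr1 mulr1.
Qed.

(** The retraction takes its values in the cube, so composing with it turns continuity within the
    cube into continuity everywhere; taking the tail only selects coordinates. *)
Lemma mcont_cube_continuous N M (j : nat) (A : coords R (N - j) -> 'M[R[i]]_M) :
  cube_continuous A -> mcont (fun k : coords R N => A (tail j k)).
Proof.
move=> Ac p q.
have w_cont : continuous (fun v : 'rV[R]_N =>
    row_of (tail j (row_cube v))).
  apply: continuous_matrix => a b.
  have bj : (j + b < N)%N by have := ltn_ord b; lia.
  have -> : (fun v : 'rV[R]_N => row_of (tail j (row_cube v)) a b) =
            @clamp R \o (fun v : 'rV[R]_N => v ord0 (Ordinal bj)).
    apply/funext => v; rewrite mxE (tnth_nth 0)/= nth_drop.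
    by have /= <- := tnth_nth 0 (row_cube v) (Ordinal bj); rewrite tnth_mktuple.
  move=> v; apply: continuous_comp; first exact: coord_continuous.
  exact: continuous_clamp.
have wC v : [set v : 'rV[R]_(N - j) | forall i, 0 <= v ord0 i <= 1]
    (row_of (tail j (row_cube v))).
  move=> i; rewrite mxE (tnth_nth 0)/= nth_drop.
  have bj : (j + i < N)%N by have := ltn_ord i; lia.
  have /= <- := tnth_nth 0 (row_cube v) (Ordinal bj).
  by rewrite tnth_mktuple clamp_itv.
pose C := [set v : 'rV[R]_(N - j) | forall i, 0 <= v ord0 i <= 1].
have key (h : R[i]^o -> R) : continuous h ->
    rcont (fun k : coords R N => h (A (tail j k) p q)).
  move=> hc.
  pose w (u : 'rV[R]_N) := row_of (tail j (row_cube u)).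
  have tupE u : tail j (row_cube u) = [tuple w u ord0 i | i < N - j].
    by apply: eq_from_tnth => i; rewrite tnth_mktuple mxE.
  rewrite /rcont; under eq_fun do rewrite tupE; move=> v.
  have AC := (subspace_continuousP _ _).1 Ac (w v) (wC v).
  have wv : w u @[u --> v] `=>` within C (nbhs (w v)).
    move=> W /(w_cont v); rewrite nbhs_simpl /=.
    by apply: filterS => u; apply; exact: wC.
  exact: (continuous_cvg _ (hc _) (continuous_cvg _
    (@coord_continuous _ M M p q _) (cvg_comp _ _ wv AC))).
by split; apply: key; [exact: continuous_Re|exact: continuous_Im].
Qed.
End cube_continuity.

(** * Measurability, boundedness and parameter integrals of continuous functions *)

Section continuous_functions_on_cube.
Context (R : realType).

Lemma measurable_cube n : measurable (cube R n).
Proof.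
rewrite (_ : cube R n = box (fun=> `[0, 1]%classic)); last first.
  by apply/seteqP; split => k kc i; have := kc i; rewrite /= in_itv.
exact: measurable_box.
Qed.

(** Tuples carry the sigma-algebra generated by the coordinates, while continuity lives on row
    vectors. The bridge is rounding: replacing each coordinate by the multiple of $1/(m+1)$ below it
    gives a function that is constant on each of countably many boxes, hence measurable, and as
    $m\to\infty$ these functions converge pointwise to [g]. *)
Lemma measurable_comp_row_of n (g : 'rV[R]_n -> R) : continuous g ->
  measurable_fun setT (fun k : coords R n => g (row_of k)).
Proof.
move=> gc.
pose q m (x : R) : R := (Num.floor (m.+1%:R * x))%:~R / m.+1%:R.
have qE m x : `|x - q m x| <= m.+1%:R^-1.
  have /andP[] := floor_itv (m.+1%:R * x).
  set z := Num.floor _ => zx xz; rewrite /q -/z.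
  have m0 : (0 : R) < m.+1%:R^-1 by rewrite invr_gt0.
  have -> : x - z%:~R / m.+1%:R = (m.+1%:R * x - z%:~R) * m.+1%:R^-1.
    by rewrite mulrBl mulrAC mulfV ?mul1r// pnatr_eq0.
  rewrite intrD in xz; rewrite normrM (ger0_norm (ltW m0)) ger0_norm ?subr_ge0//.
  by rewrite -[leRHS]mul1r ler_pM2r//; lra.
pose h m (k : coords R n) := g (\row_i q m (tnth k i)).
apply: (@measurable_fun_cvg _ _ _ _ h) => [m|k _].
  move=> _ Y mY; rewrite setTI.
  pose zr (z : {ffun 'I_n -> int}) : 'rV[R]_n := \row_i ((z i)%:~R / m.+1%:R).
  pose E (z : {ffun 'I_n -> int}) := if g (zr z) \in Y then
    box (fun i => [set x : measurableTypeR R | Num.floor (m.+1%:R * x) = z i]) else set0.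
  rewrite (_ : _ @^-1` Y = \bigcup_z E z).
    apply: countable_bigcupT_measurable; first exact: countableP.
    move=> z; rewrite /E; case: ifP => // _; apply: measurable_box => i.
    rewrite (_ : mkset _ = `[((z i)%:~R / m.+1%:R : R), ((z i + 1)%:~R / m.+1%:R : R)[%classic).
      exact: measurable_itv.
    have m0 : (0 : R) < m.+1%:R by [].
    apply/seteqP; split => x /=; rewrite in_itv/= ler_pdivrMr// ltr_pdivlMr// (mulrC x).
      by move/eqP; rewrite floor_eq.
    by rewrite -floor_eq => /eqP.
  apply/seteqP; split => [k hkY|k [z _]].
    pose z := [ffun i => Num.floor (m.+1%:R * (tnth k i : R))].
    have zE : zr z = \row_i q m (tnth k i).
      by apply/rowP => i; rewrite !mxE ffunE.
    exists z => //; rewrite /E zE mem_set//.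
    by move=> i /=; rewrite ffunE.
  rewrite /E; case: ifP => // /set_mem gY kz.
  rewrite /preimage/= /h (_ : \row_i _ = zr z)//.
  by apply/rowP => i; rewrite !mxE /q; have /= -> := kz i.
apply: (continuous_cvg _ (gc (row_of k))).
move=> A [P Pk PA]; rewrite nbhs_simpl /=.
have : \forall m \near \oo, forall i j, P i j ((\row_i q m (tnth k i)) i j).
  apply: filter_forall => i; apply: filter_forall => j.
  have qc : q m (tnth k j) @[m --> \oo] --> (tnth k j : R).
    apply/cvgrPdist_lt => e e0; near=> m.
    by apply: (le_lt_trans (qE _ _)); near: m; exact: near_infty_natSinv_lt (PosNum e0).
  under eq_near do rewrite mxE.
  by apply: qc; have := Pk i j; rewrite mxE.
by apply: filterS => m Pm; exact: PA.
Unshelve. all: by end_near. Qed.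

Lemma rcont_measurableT n (f : coords R n -> R) : rcont f ->
  measurable_fun setT (fun k => f (row_cube (row_of k))).
Proof. by move=> fc; exact: (measurable_comp_row_of fc). Qed.

Lemma rcont_measurable n (f : coords R n -> R) : rcont f ->
  measurable_fun (cube R n) f.
Proof.
move=> /rcont_measurableT mf.
apply: (eq_measurable_fun (fun k => f (row_cube (row_of k)))).
  by move=> k /set_mem kc; rewrite row_ofK.
by apply: measurable_funTS.
Qed.

Lemma rcont_bounded n (f : coords R n -> R) : rcont f ->
  exists C : R, forall k, cube R n k -> `|f k| <= C.
Proof.
move=> fc.
have := @rV_compact R n (fun=> `[0, 1]%classic) (fun=> @segment_compact R 0 1).
set K := mkset _ => Kc.
have fcw : {within K, continuous (fun v => f (row_cube v) : R^o)}.
  by apply: continuous_subspaceT => v; exact: (fc v).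
have /compact_bounded[C [_ CP]] := continuous_compact fcw Kc.
exists (C + 1) => k kc; apply: (CP (C + 1)); first by rewrite ltrDl.
exists (row_of k); last by rewrite row_ofK.
by move=> i; rewrite mxE/= in_itv; exact: kc.
Qed.

Definition set_row n (j : nat) (x : R) (v : 'rV[R]_n) : 'rV[R]_n :=
  \row_i (if i == j :> nat then x else v ord0 i).

Lemma set_coord_row_cube n j x (v : 'rV[R]_n) : 0 <= x <= 1 ->
  set_coord j x (row_cube v) = row_cube (set_row j x v).
Proof.
move=> x01; apply: eq_from_tnth => i; rewrite !tnth_mktuple mxE.
by case: ifP => // _; rewrite clamp_id.
Qed.

Lemma continuous_set_row n j :
  continuous (fun p : R * 'rV[R]_n => set_row j p.1 p.2).
Proof.
apply: continuous_matrix => a b; under eq_fun do rewrite mxE.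
case: (b == j :> nat) => p; first exact: cvg_fst.
exact: (@continuous_comp _ _ _ snd (fun v : 'rV[R]_n => v ord0 b) p
  cvg_snd (@coord_continuous R 1 n ord0 b _)).
Qed.

(** Compactness of [[0, 1]] upgrades continuity at each pair $(x,v)$ to closeness uniform in $x$ for
    $v'$ near $v$, which survives integration. *)
Lemma rcont_coord_integral n j (f : coords R n -> R) : rcont f ->
  rcont (fun k => \int[lebesgue_measure]_(x in `[0, 1]) f (set_coord j x k)).
Proof.
move=> fc.
pose g (p : R * 'rV[R]_n) := f (row_cube (set_row j p.1 p.2)).
have gc : continuous g.
  by move=> p; exact: (continuous_comp (@continuous_set_row n j p) (fc _)).
have gc1 v : continuous (fun x => g (x, v)).
  have sc : continuous (fun x : R => set_row j x v).
    apply: continuous_matrix => a b; under eq_fun do rewrite mxE.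
    by case: (b == j :> nat) => x; [exact: cvg_id|exact: cvg_cst].
  by move=> x; exact: (continuous_comp (sc x) (fc _)).
have ig v : lebesgue_measure.-integrable `[0, 1]%classic (EFin \o (fun x => g (x, v))).
  apply: continuous_compact_integrable; first exact: segment_compact.
  by apply: continuous_subspaceT; exact: gc1.
rewrite /rcont (_ : (fun v => _) =
  (fun v => \int[lebesgue_measure]_(x in `[0, 1]) g (x, v))); last first.
  apply/funext => v; apply: eq_Rintegral => x; rewrite inE/= in_itv/= => x01.
  by rewrite set_coord_row_cube.
move=> v; apply/(@cvgrPdist_lt _ _ _ _ (nbhs_filter (v : 'rV[R]_n))) => e e0.
have e20 : 0 < e / 2 by rewrite divr_gt0.
(* Both [g (x', v)] and [g (x', v')] are compared with [g (x, v)], each within [e / 4]. The sum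
   [e / 2] leaves room for the strict inequality after integration. *)
have e40 : 0 < e / 4 by rewrite divr_gt0.
pose P (v' : 'rV[R]_n) (x : R) := `|g (x, v) - g (x, v')| < e / 2.
have cov : \forall v' \near v, `[0, 1]%classic `<=` P v'.
  have NC := (compact_near_coveringP _).1 (@segment_compact R 0 1) _
    (nbhs (v : 'rV[R]_n)) P (nbhs_filter _).
  apply: NC => x _.
  have H1 := (cvgrPdist_lt _ _).1 (gc (x, v)) _ e40.
  have [[U V] /= [Ux Vv] UV] := H1.
  exists (U, V) => // -[x' v'] /= [Ux' Vv'].
  have := UV (x', v') (conj Ux' Vv').
  have := UV (x', v) (conj Ux' (nbhs_singleton Vv)) => /=.
  rewrite /P !ltr_norml => /andP[a1 a2] /andP[b1 b2].
  by apply/andP; split; lra.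
apply: filterS cov => v' Pv'.
rewrite -RintegralB//.
have iB : lebesgue_measure.-integrable `[0, 1]%classic
    (EFin \o (fun x => g (x, v) - g (x, v'))).
  rewrite (_ : _ \o _ = ((EFin \o (fun x => g (x, v))) \- (EFin \o (fun x => g (x, v'))))%E)//.
  by apply: integrableB.
apply: (le_lt_trans (le_normr_Rintegral _ iB)) => //.
apply: (@le_lt_trans _ _ (\int[lebesgue_measure]_(x in `[0, 1]) (e / 2))).
  apply: le_Rintegral => //.
  - have := integrable_norm iB; exact.
  - apply: continuous_compact_integrable; first exact: segment_compact.
    by apply: continuous_subspaceT => ?; exact: cvg_cst.
  - by move=> x x01; apply/ltW; exact: Pv'.
have l01 : lebesgue_measure (`[0, 1]%classic : set (measurableTypeR R)) = 1%:E.
  by rewrite lebesgue_measure_itv/= lte01 oppr0 adde0.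
by rewrite Rintegral_cst// [X in fine X]l01 mulr1; lra.
Qed.

Lemma mcont_coord_integral n j p q (F : coords R n -> 'M[R[i]]_(p, q)) :
  mcont F -> mcont (coord_integral j F).
Proof.
move=> Fc a b; have [F1 F2] := Fc a b.
split; under eq_fun do rewrite mxE/=.
  exact: (rcont_coord_integral (j := j) F1).
exact: (rcont_coord_integral (j := j) F2).
Qed.

End continuous_functions_on_cube.

(** * Partial integrals *)

Section matrix_integral.
Context (R : realType) d (T : measurableType d) (mu : {measure set T -> \bar R}).
Context (D : set T) (mD : measurable D).

Definition mx_integrable m n (F : T -> 'M[R[i]]_(m, n)) : Prop := forall p q,
  mu.-integrable D (fun x => (complex.Re (F x p q))%:E) /\
  mu.-integrable D (fun x => (complex.Im (F x p q))%:E).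

Lemma eq_mx_integral m n (F G : T -> 'M[R[i]]_(m, n)) :
  (forall x, D x -> F x = G x) -> mx_integral mu D F = mx_integral mu D G.
Proof.
move=> FG; apply/matrixP => p q; rewrite !mxE.
by congr Complex; apply: eq_Rintegral => x /set_mem Dx; rewrite FG.
Qed.

Let integrableDZ (f g : T -> R) (a b : R) :
  mu.-integrable D (EFin \o f) -> mu.-integrable D (EFin \o g) ->
  mu.-integrable D (fun x => (a * f x + b * g x)%:E).
Proof.
move=> fi gi; under eq_fun do rewrite EFinD !EFinM.
by apply: integrableD => //; exact: integrableZl.
Qed.

Let RintegralDZ (f g : T -> R) (a b : R) :
  mu.-integrable D (EFin \o f) -> mu.-integrable D (EFin \o g) ->
  \int[mu]_(x in D) (a * f x + b * g x)
  = a * \int[mu]_(x in D) f x + b * \int[mu]_(x in D) g x.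
Proof.
move=> fi gi; have Zi c h : mu.-integrable D (EFin \o h) ->
    mu.-integrable D (EFin \o (fun x => c * h x)).
  move=> hi; rewrite (_ : _ \o _ = (fun x => c%:E * (EFin \o h) x)%E)//.
  exact: integrableZl.
by rewrite RintegralD ?RintegralZl//; exact: Zi.
Qed.

Lemma mx_integrableD m n (F G : T -> 'M[R[i]]_(m, n)) :
  mx_integrable F -> mx_integrable G -> mx_integrable (fun x => F x + G x).
Proof.
move=> Fi Gi p q; have [F1 F2] := Fi p q; have [G1 G2] := Gi p q.
split; under eq_fun do rewrite mxE raddfD/= EFinD.
  exact: (integrableD _ F1 G1).
exact: (integrableD _ F2 G2).
Qed.

Lemma mx_integralD m n (F G : T -> 'M[R[i]]_(m, n)) :
  mx_integrable F -> mx_integrable G ->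
  mx_integral mu D (fun x => F x + G x) = mx_integral mu D F + mx_integral mu D G.
Proof.
move=> Fi Gi; apply/matrixP => p q; rewrite !mxE.
have [F1 F2] := Fi p q; have [G1 G2] := Gi p q.
apply/eqP; rewrite eq_complex/=; apply/andP; split; apply/eqP.
  by under eq_Rintegral do rewrite mxE raddfD/=; rewrite RintegralD.
by under eq_Rintegral do rewrite mxE raddfD/=; rewrite RintegralD.
Qed.

Lemma mx_integrableZ m n (F : T -> 'M[R[i]]_(m, n)) (c : R[i]) :
  mx_integrable F -> mx_integrable (fun x => c *: F x).
Proof.
move=> Fi p q; have [F1 F2] := Fi p q; split.
  under eq_fun do rewrite mxE Re_mulc -mulNr.
  exact: (integrableDZ _ _ F1 F2).
under eq_fun do rewrite mxE Im_mulc.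
exact: (integrableDZ _ _ F2 F1).
Qed.

Lemma mx_integralZ m n (F : T -> 'M[R[i]]_(m, n)) (c : R[i]) :
  mx_integrable F ->
  mx_integral mu D (fun x => c *: F x) = c *: mx_integral mu D F.
Proof.
move=> Fi; apply/matrixP => p q; rewrite !mxE; have [F1 F2] := Fi p q.
apply/eqP; rewrite eq_complex Re_mulc Im_mulc/=; apply/andP; split; apply/eqP.
  under eq_Rintegral do rewrite mxE Re_mulc -mulNr.
  by rewrite (RintegralDZ _ _ F1 F2) mulNr.
under eq_Rintegral do rewrite mxE Im_mulc.
by rewrite (RintegralDZ _ _ F2 F1).
Qed.

Lemma mx_integral_sum m n (I : Type) (r : seq I) (F : I -> T -> 'M[R[i]]_(m, n)) :
  (forall i, mx_integrable (F i)) ->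
  mx_integrable (fun x => \sum_(i <- r) F i x) /\
  mx_integral mu D (fun x => \sum_(i <- r) F i x)
  = \sum_(i <- r) mx_integral mu D (F i).
Proof.
move=> Fi; elim: r => [|i r [IHi IH]].
  split.
    move=> p q; split; under eq_fun do rewrite big_nil mxE/=;
      exact: integrable0.
  rewrite big_nil; apply/matrixP => p q; rewrite !mxE.
  under eq_Rintegral do rewrite big_nil mxE/=.
  under [X in Complex _ X]eq_Rintegral do rewrite big_nil mxE/=.
  by rewrite !Rintegral_cst// !mul0r.
split; first by under eq_fun do rewrite big_cons; exact: mx_integrableD.
under [X in mx_integral _ _ X]eq_fun do rewrite big_cons.
by rewrite big_cons mx_integralD// IH.
Qed.

Lemma mx_integral_mulr m n p (F : T -> 'M[R[i]]_(m, n)) (C : 'M[R[i]]_(n, p)) :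
  mx_integrable F ->
  mx_integral mu D (fun x => F x *m C) = mx_integral mu D F *m C.
Proof.
move=> Fi; apply/matrixP => a b.
(* An entry of the product is a linear combination of scalar functions; seen as 1 by 1 matrices,
   these fall under the sum and scaling rules already proved. *)
pose G (l : 'I_n) x : 'M[R[i]]_1 := C l b *: (F x a l)%:M.
have Gi l : mx_integrable (fun x => ((F x a l)%:M : 'M[R[i]]_1)).
  move=> i j; have [F1 F2] := Fi a l; rewrite (ord1 i) (ord1 j).
  by split; under eq_fun do rewrite mxE eqxx mulr1n.
have := (mx_integral_sum (index_enum 'I_n) (fun l => mx_integrableZ (C l b) (Gi l))).2.
move/matrixP/(_ ord0 ord0); rewrite summxE !mxE => E.
pose H x : 'M[R[i]]_1 := \sum_(l <- index_enum 'I_n) C l b *: (F x a l)%:M.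
transitivity (Complex (\int[mu]_(x in D) complex.Re (H x ord0 ord0))
                      (\int[mu]_(x in D) complex.Im (H x ord0 ord0))).
  by congr Complex; apply: eq_Rintegral => x _; rewrite /H summxE mxE; congr (_ _);
    apply: eq_bigr => l _; rewrite !mxE eqxx mulr1n mulrC.
rewrite E; apply: eq_bigr => l _; rewrite mx_integralZ// !mxE mulrC; congr (_ * _).
by congr Complex; apply: eq_Rintegral => x _; rewrite mxE eqxx mulr1n.
Qed.

End matrix_integral.

(** * Iterated averages, and functions of the last variables only *)

Section sections.
Context (R : realType).

Lemma set_prefix_cube j N (t : coords R j) (k : coords R N) :
  cube R j t -> cube R N k -> cube R N (set_prefix t k).
Proof.
move=> tc kc i; have [ij|ji] := ltnP i j.
  by rewrite (tnth_set_prefixl _ _ ij); exact: tc.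
by rewrite tnth_set_prefixr//; exact: kc.
Qed.

Lemma set_prefix_cubeN j N (t : coords R j) (k : coords R N) : (j <= N)%N ->
  cube R N (set_prefix t k) -> cube R j t.
Proof.
move=> jN sc i.
have ij : (widen_ord jN i < j)%N by exact: (ltn_ord i).
have := sc (widen_ord jN i); rewrite (tnth_set_prefixl _ _ ij).
by rewrite (_ : Ordinal ij = i)//; exact/val_inj.
Qed.

Lemma set_coord_cube N j x (k : coords R N) :
  0 <= x <= 1 -> cube R N k -> cube R N (set_coord j x k).
Proof. by move=> x01 kc i; rewrite tnth_mktuple; case: ifP. Qed.

Lemma set_prefix0 N (t : coords R 0) (k : coords R N) : set_prefix t k = k.
Proof. by apply: eq_from_tnth => i; rewrite tnth_set_prefixr. Qed.

Lemma set_prefix_rcons N j (s : coords R j) x (k : coords R N) : (j < N)%N ->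
  set_prefix (tuple_rcons (s, x)) k = set_prefix s (set_coord j x k).
Proof.
move=> jN; apply: eq_from_tnth => i; rewrite tnth_mktuple [RHS]tnth_mktuple /=.
rewrite nth_rcons size_tuple tnth_mktuple.
case: ltngtP => ij.
- by apply: set_nth_default; rewrite size_tuple.
- by rewrite nth_default// size_tuple ltnW.
- by rewrite nth_default// size_tuple ij.
Qed.

Lemma rcont_section_integrable j N (f : coords R N -> R) k :
  rcont f -> cube R N k ->
  (lebesgue_cube R j).-integrable (cube R j) (fun t => (f (set_prefix t k))%:E).
Proof.
move=> fc kc.
have msp : measurable_fun setT (fun t : coords R j => set_prefix t k).
  rewrite (_ : (fun t => _) = (fun p => set_prefix p.1 p.2) \o (fun t => (t, k)))//.
  by apply: measurableT_comp; [exact: measurable_set_prefix|exact: measurable_pair2].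
apply: measurable_bounded_integrable => //=.
- exact: measurable_cube.
- by rewrite (le_lt_trans (probability_le1 _ _)) ?ltry//; exact: measurable_cube.
- apply: (eq_measurable_fun (fun t => f (row_cube (row_of (set_prefix t k))))).
    by move=> t /set_mem tc; rewrite row_ofK//; exact: set_prefix_cube.
  apply: measurable_funTS.
  exact: (measurableT_comp (rcont_measurableT fc) msp).
- have [C fC] := rcont_bounded fc.
  exists C; split; first by rewrite num_real.
  move=> x Cx t tc; apply: (le_trans _ (ltW Cx)).
  by apply: fC; exact: set_prefix_cube.
Qed.

Lemma mcont_section_integrable j N m n (F : coords R N -> 'M[R[i]]_(m, n)) k :
  mcont F -> cube R N k ->
  mx_integrable (lebesgue_cube R j) (cube R j) (fun t => F (set_prefix t k)).
Proof.
by move=> Fc kc p q; have [F1 F2] := Fc p q;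
  split; [exact: (rcont_section_integrable _ F1)|exact: (rcont_section_integrable _ F2)].
Qed.

Lemma prefix_integral0 N m n (F : coords R N -> 'M[R[i]]_(m, n)) k :
  prefix_integral 0 F k = F k.
Proof.
have c0 : cube R 0 = setT by apply/seteqP; split => // t _ [].
apply/matrixP => p q; rewrite !mxE c0.
have E (f : coords R N -> R) :
    \int[lebesgue_cube R 0]_t f (set_prefix t k) = f k.
  under eq_Rintegral do rewrite set_prefix0.
  by rewrite Rintegral_cst// [X in fine X](probability_setT (lebesgue_cube R 0)) mulr1.
by rewrite (E (fun k => complex.Re (F k p q))) (E (fun k => complex.Im (F k p q)));
  case: (F k p q).
Qed.

Lemma integral_lebesgue01 (f : R -> R) :
  \int[@lebesgue01 R]_(x in `[0, 1]) f x = \int[lebesgue_measure]_(x in `[0, 1]) f x.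
Proof.
congr fine; apply: eq_measure_integral => A mA A01.
by rewrite /= /lebesgue01 /mrestr setIidl.
Qed.

(** Fubini along [tuple_rcons], with the last averaged variable outermost: the order in which the
    continued fractions take their averages. *)
Lemma rcont_prefix_integralS j N (f : coords R N -> R) k : (j < N)%N ->
  rcont f -> cube R N k ->
  \int[lebesgue_cube R j.+1]_(t in cube R j.+1) f (set_prefix t k) =
  \int[lebesgue_measure]_(x in `[0, 1])
    \int[lebesgue_cube R j]_(s in cube R j) f (set_prefix s (set_coord j x k)).
Proof.
move=> jN fc kc.
(* The measure lives on all tuples, so [f] is cut off to the cube. The cut-off splits, because
   appending [x] to [s] gives a point of the cube exactly when [s] is in the cube and [x] in
   [[0, 1]]. *)
pose h := (fun t => f (set_prefix t k)) \_ (cube R j.+1).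
have hi : (lebesgue_cube R j.+1).-integrable setT (EFin \o h).
  have := rcont_section_integrable j.+1 fc kc.
  rewrite (integrable_mkcond _ (@measurable_cube R j.+1)).
  by rewrite -restrict_EFin.
have mh : measurable_fun setT h.
  by have /integrableP[/measurable_EFinP] := hi.
have hpi : (lebesgue_cube R j \x @lebesgue01 R)%E.-integrable setT
    (EFin \o (h \o @tuple_rcons R j)).
  apply/integrableP; split.
    apply/measurable_EFinP; apply: measurableT_comp => //.
    exact: measurable_tuple_rcons.
  have /integrableP[_] := hi.
  rewrite (ge0_integral_lebesgue_cube (@measurable_tuple_rcons R j)
    (pushforward_tuple_rcons (n := j)))//.
  by apply: measurableT_comp => //; exact/measurable_EFinP.
rewrite Rintegral_mkcond -/h.
transitivity (fine (\int[(lebesgue_cube R j \x @lebesgue01 R)%E]_p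
    (h (tuple_rcons p))%:E)).
  congr fine.
  have mh' : measurable_fun setT (EFin \o h) by exact/measurable_EFinP.
  have hpi' := hpi; rewrite -(@preimage_setT _ _ (@tuple_rcons R j)) in hpi'.
  have := integral_pushforward (@measurable_tuple_rcons R j) mh' hpi' measurableT.
  rewrite preimage_setT => <-.
  apply: eq_measure_integral; first exact: measurable_tuple_rcons.
  by move=> mt A mA _; exact/esym/pushforward_tuple_rcons.
rewrite -(@integral21_prod_meas1 _ _ _ _ _ _ _ _ hpi).
rewrite -integral_lebesgue01 Rintegral_mkcond; congr fine.
apply: eq_integral => x _; rewrite /fubini_G/= patchE.
case: ifPn => [/set_mem|/negP x01].
  rewrite /= in_itv/= => x01.
  have hE s : h (tuple_rcons (s, x)) =
      ((fun s => f (set_prefix s (set_coord j x k))) \_ (cube R j)) s.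
    rewrite /h !patchE set_prefix_rcons//.
    congr (if _ then _ else _); apply/idP/idP => /set_mem sc; apply/mem_set.
      move=> i; have := sc (lift ord_max i).
      by rewrite tnth_tuple_rcons liftK.
    move=> i; rewrite tnth_tuple_rcons.
    by case: unliftP => [i' _|_] //=; exact: sc.
  under eq_integral do rewrite hE.
  rewrite Rintegral_mkcond /Rintegral fineK//.
  have := rcont_section_integrable j fc (set_coord_cube j x01 kc).
  rewrite (integrable_mkcond _ (@measurable_cube R j)).
  rewrite (@restrict_EFin _ _ (fun t => f (set_prefix t (set_coord j x k))) (cube R j)).
  by move=> /integrable_fin_num; apply.
rewrite integral0_eq// => s _; rewrite /h patchE.
case: ifPn => // /set_mem sc; exfalso; apply: x01; apply/mem_set.
by rewrite /= in_itv/=; have := sc ord_max; rewrite tnth_tuple_rcons unlift_none.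
Qed.

Lemma prefix_integralS j N m n (F : coords R N -> 'M[R[i]]_(m, n)) k :
  (j < N)%N -> mcont F -> cube R N k ->
  prefix_integral j.+1 F k = coord_integral j (prefix_integral j F) k.
Proof.
move=> jN Fc kc; apply/matrixP => p q; have [F1 F2] := Fc p q; rewrite !mxE.
rewrite (rcont_prefix_integralS jN F1 kc) (rcont_prefix_integralS jN F2 kc).
by congr Complex; apply: eq_Rintegral => x _; rewrite mxE.
Qed.

Lemma eq_coord_integral n j p q (F F' : coords R n -> 'M[R[i]]_(p, q)) k :
  (forall k, cube R n k -> F k = F' k) -> cube R n k ->
  coord_integral j F k = coord_integral j F' k.
Proof.
move=> FF kc; apply: eq_mx_integral => x; rewrite /= in_itv/= => x01.
by apply: FF; exact: set_coord_cube.
Qed.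


(** Encodes being a function of $\mathbf k_j$ while keeping all [N] coordinates as the domain, so
    that functions of different tails can be multiplied and averaged together. *)
Definition tail_invariant N (X : Type) (j : nat) (w : coords R N -> X) : Prop :=
  forall k k' : coords R N, drop j k = drop j k' -> w k = w k'.

Lemma tail_invariantP N X j (w : coords R N -> X) (t : coords R j) k :
  tail_invariant j w -> w (set_prefix t k) = w k.
Proof.
apply; apply: (@eq_from_nth _ 0); rewrite !size_drop !size_tuple// => i iN.
have jiN : (j + i < N)%N by lia.
rewrite !nth_drop.
have /= <- := tnth_nth 0 k (Ordinal jiN).
have /= <- := tnth_nth 0 (set_prefix t k) (Ordinal jiN).
by rewrite tnth_set_prefixr//= leq_addr.
Qed.

Lemma tail_invariant_prefix_integral N j m n (F : coords R N -> 'M[R[i]]_(m, n)) :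
  tail_invariant j (prefix_integral j F).
Proof.
move=> k k' kk'; apply: eq_mx_integral => t _; congr F.
apply: eq_from_tnth => i; have [ij|ji] := ltnP i j.
  by rewrite !(tnth_set_prefixl _ _ ij).
rewrite !tnth_set_prefixr// !(tnth_nth 0).
by rewrite -(subnKC ji) -!nth_drop kk'.
Qed.

Lemma tail_invariant_coord_integral n j p q (F : coords R n -> 'M[R[i]]_(p, q)) :
  tail_invariant j F -> tail_invariant j.+1 (coord_integral j F).
Proof.
move=> Fj k k' kk'; apply: eq_mx_integral => x _; apply: Fj.
apply: (@eq_from_nth _ 0); rewrite !size_drop !size_tuple// => i iN.
have jiN : (j + i < n)%N by lia.
rewrite !nth_drop.
have /= <- := tnth_nth 0 (set_coord j x k) (Ordinal jiN).
have /= <- := tnth_nth 0 (set_coord j x k') (Ordinal jiN).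
rewrite !tnth_mktuple/=; case: eqP => // /eqP ji.
rewrite !(tnth_nth 0)/= (_ : (j + i)%N = (j.+1 + i.-1)%N); last lia.
by rewrite -!nth_drop kk'.
Qed.


Lemma tail_invariant_le N X i j (w : coords R N -> X) : (i <= j)%N ->
  tail_invariant j w -> tail_invariant i w.
Proof.
move=> ij wj k k' kk'; apply: wj.
by rewrite -(subnK ij) -!drop_drop kk'.
Qed.

(** Along a fibre of the averaging [w] is constant, so it leaves the integral. Everything that is
    pulled out of an average later goes through this rule. *)
Lemma prefix_integral_mulr N j m n p (X : coords R N -> 'M[R[i]]_(m, n))
    (w : coords R N -> 'M[R[i]]_(n, p)) k : mcont X -> tail_invariant j w ->
  cube R N k ->
  prefix_integral j (fun k => X k *m w k) k = prefix_integral j X k *m w k.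
Proof.
move=> Xc wj kc; rewrite /prefix_integral.
under [X in mx_integral _ _ X]eq_fun do rewrite (tail_invariantP _ _ wj).
by apply: mx_integral_mulr; [exact: measurable_cube|exact: mcont_section_integrable].
Qed.

End sections.

(** * Bounded operators on L2 *)

Section squared_norms.
Context (R : realType).

(** The squared modulus, kept real-valued because the norm of [R[i]] takes its values in [R[i]]. *)
Definition csq (z : R[i]) : R := complex.Re z ^+ 2 + complex.Im z ^+ 2.

Definition nsq n (v : 'cV[R[i]]_n) : R := \sum_(p < n) csq (v p ord0).

Lemma csq_ge0 z : 0 <= csq z.
Proof. by rewrite addr_ge0 ?sqr_ge0. Qed.

Lemma csqM x y : csq (x * y) = csq x * csq y.
Proof. by rewrite /csq Re_mulc Im_mulc; ring. Qed.

Lemma csqD x y : csq (x + y) <= 2 * csq x + 2 * csq y.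
Proof.
rewrite /csq !raddfD/=; have := sqr_ge0 (complex.Re x - complex.Re y).
have := sqr_ge0 (complex.Im x - complex.Im y); nra.
Qed.

(** The constant comes from iterating [csqD] and is far from sharp; only boundedness of operators is
    at stake. *)
Lemma csq_sum (I : Type) (r : seq I) (z : I -> R[i]) :
  csq (\sum_(i <- r) z i) <= 2 ^+ size r * \sum_(i <- r) csq (z i).
Proof.
elim: r => [|i r IH].
  by rewrite !big_nil/= mulr0 /csq/= expr0n addr0.
rewrite !big_cons/=; apply: (le_trans (csqD _ _)).
have S0 : 0 <= \sum_(j <- r) csq (z j) by apply: sumr_ge0 => j _; exact: csq_ge0.
have p1 : 1 <= 2 ^+ size r :> R by rewrite exprn_ege1// ler1n.
by rewrite exprS; have := csq_ge0 (z i); nra.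
Qed.

Lemma nsq_ge0 n (v : 'cV[R[i]]_n) : 0 <= nsq v.
Proof. by apply: sumr_ge0 => p _; exact: csq_ge0. Qed.

Lemma nsq0_eq0 n (v : 'cV[R[i]]_n) : nsq v = 0 -> v = 0.
Proof.
move=> v0; apply/colP => p; rewrite mxE.
have := v0; rewrite /nsq => /eqP; rewrite psumr_eq0; last by move=> *; exact: csq_ge0.
move=> /allP/(_ p (mem_index_enum _)) /=.
rewrite /csq paddr_eq0 ?sqr_ge0// !sqrf_eq0.
by case: (v p ord0) => a b /= /andP[/eqP -> /eqP ->].
Qed.

Lemma nsq0 n : nsq (0 : 'cV[R[i]]_n) = 0.
Proof. by rewrite /nsq big1// => p _; rewrite mxE /csq/= expr0n addr0. Qed.

Lemma nsqD n (u v : 'cV[R[i]]_n) : nsq (u + v) <= 2 * nsq u + 2 * nsq v.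
Proof.
rewrite /nsq !mulr_sumr -big_split/=; apply: ler_sum => p _.
by rewrite mxE; exact: csqD.
Qed.

Lemma nsqZ n a (v : 'cV[R[i]]_n) : nsq (a *: v) = csq a * nsq v.
Proof. by rewrite /nsq mulr_sumr; apply: eq_bigr => p _; rewrite mxE csqM. Qed.

Lemma nsq_mulmx m n (X : 'M[R[i]]_(m, n)) (v : 'cV[R[i]]_n) (C : R) :
  (forall p q, csq (X p q) <= C) -> nsq (X *m v) <= m%:R * 2 ^+ n * C * nsq v.
Proof.
move=> XC; rewrite [leLHS]/nsq.
apply: (@le_trans _ _ (\sum_(p < m) 2 ^+ n * (C * nsq v))); last first.
  by rewrite sumr_const card_ord -[leLHS]mulr_natl !mulrA.
apply: ler_sum => p _; rewrite mxE; apply: (le_trans (csq_sum _ _)).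
rewrite (_ : size _ = n) ?ler_wpM2l ?exprn_ge0//; last first.
  by rewrite -sum1_size sum1_card card_ord.
rewrite /nsq mulr_sumr; apply: ler_sum => q _.
by rewrite csqM ler_wpM2r// csq_ge0.
Qed.

End squared_norms.

Section L2_calculus.
Context (R : realType) (N M : nat).
Notation field := (coords R N -> 'cV[R[i]]_M).
Implicit Types u v : field.

Lemma sqnormE u : sqnorm u = (\int[lebesgue_cube R N]_(k in cube R N) (nsq (u k))%:E)%E.
Proof. by []. Qed.

Definition mfield u : Prop := forall p,
  measurable_fun (cube R N) (fun k => complex.Re (u k p ord0)) /\
  measurable_fun (cube R N) (fun k => complex.Im (u k p ord0)).

Lemma measurable_nsq u : mfield u -> measurable_fun (cube R N) (fun k => nsq (u k)).
Proof.
move=> mu; apply: measurable_sum => p; have [mu1 mu2] := mu p.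
by apply: measurable_funD; exact: measurable_funX.
Qed.

Let measurable_ensq u : mfield u ->
  measurable_fun (cube R N) (fun k => (nsq (u k))%:E).
Proof. by move=> /measurable_nsq mu; exact/measurable_EFinP. Qed.

Lemma sqnorm_ge0 u : (0 <= sqnorm u)%E.
Proof. by apply: integral_ge0 => k _; rewrite lee_fin; exact: nsq_ge0. Qed.

Lemma le_sqnorm u v (c : R) : mfield u -> mfield v -> 0 <= c ->
  (forall k, cube R N k -> nsq (u k) <= c * nsq (v k)) ->
  (sqnorm u <= c%:E * sqnorm v)%E.
Proof.
move=> mu mv c0 uv; rewrite !sqnormE -ge0_integralZl//; last 3 first.
- exact: measurable_cube.
- exact: measurable_ensq.
- by move=> k _; rewrite lee_fin; exact: nsq_ge0.
apply: ge0_le_integral.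
- exact: measurable_cube.
- by move=> k _; rewrite lee_fin; exact: nsq_ge0.
- exact: measurable_ensq.
- by apply: emeasurable_funM; [exact: measurable_cst|exact: measurable_ensq].
- by move=> k kc; rewrite -EFinM lee_fin; exact: uv.
Qed.

Lemma mfieldD u v : mfield u -> mfield v -> mfield (fun k => u k + v k).
Proof.
move=> mu mv p; have [mu1 mu2] := mu p; have [mv1 mv2] := mv p.
split; under eq_fun do rewrite mxE raddfD/=; exact: measurable_funD.
Qed.

Lemma mfield_mulmx (X : coords R N -> 'M[R[i]]_M) u : mcont X -> mfield u ->
  mfield (fun k => X k *m u k).
Proof.
move=> Xc mu p; split; under eq_fun do rewrite mxE raddf_sum/=.
  apply: measurable_sum => q; have [mu1 mu2] := mu q; have [X1 X2] := Xc p q.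
  under eq_fun do rewrite Re_mulc.
  by apply: measurable_funB; apply: measurable_funM => //; exact: rcont_measurable.
apply: measurable_sum => q; have [mu1 mu2] := mu q; have [X1 X2] := Xc p q.
under eq_fun do rewrite Im_mulc.
by apply: measurable_funD; apply: measurable_funM => //; exact: rcont_measurable.
Qed.

Lemma sqnormD u v : mfield u -> mfield v ->
  (sqnorm (fun k => (u k + v k)%R) <= 2%:E * sqnorm u + 2%:E * sqnorm v)%E.
Proof.
move=> mu mv; rewrite !sqnormE.
have mZ w : mfield w -> measurable_fun (cube R N) (fun k => (2%:E * (nsq (w k))%:E)%E).
  by move=> mw; apply: emeasurable_funM; [exact: measurable_cst|exact: measurable_ensq].
have ge0 w k : (0 <= (nsq (w k : 'cV[R[i]]_M))%:E)%E by rewrite lee_fin; exact: nsq_ge0.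
have mc := @measurable_cube R N.
rewrite -!ge0_integralZl//; [|exact: measurable_ensq..].
rewrite -ge0_integralD//; [|by move=> k _; rewrite mule_ge0|exact: mZ
                          |by move=> k _; rewrite mule_ge0|exact: mZ].
apply: ge0_le_integral => //.
- exact: (measurable_ensq (mfieldD mu mv)).
- by apply: emeasurable_funD; exact: mZ.
- by move=> k kc; rewrite -!EFinM -EFinD lee_fin; exact: nsqD.
Qed.

Lemma mcont_csq_bounded m n (X : coords R N -> 'M[R[i]]_(m, n)) : mcont X ->
  exists2 C : R, 0 <= C & forall k p q, cube R N k -> csq (X k p q) <= C.
Proof.
move=> Xc.
have H p q : exists C : R, forall k, cube R N k -> csq (X k p q) <= C.
  have [/rcont_bounded[C1 X1] /rcont_bounded[C2 X2]] := Xc p q.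
  exists (C1 ^+ 2 + C2 ^+ 2) => k kc; rewrite /csq.
  by rewrite lerD// -[leLHS]real_normK ?num_real// lerXn2r ?nnegrE//;
    [exact: le_trans (X1 k kc)|exact: X1|exact: le_trans (X2 k kc)|exact: X2].
have [C CP] := choice (fun pq => H pq.1 pq.2).
exists (\sum_pq `|C pq|) => [|k p q kc]; first by apply: sumr_ge0.
rewrite (bigD1 (p, q))//= -[leLHS]addr0 lerD//; last exact: sumr_ge0.
by apply: le_trans (ler_norm _); exact: (CP (p, q)).
Qed.

Lemma sqnorm_mulmx (X : coords R N -> 'M[R[i]]_M) : mcont X ->
  exists2 c : R, 0 <= c & forall u, mfield u ->
    (sqnorm (fun k => (X k *m u k)%R) <= c%:E * sqnorm u)%E.
Proof.
move=> Xc; have [C C0 XC] := mcont_csq_bounded Xc.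
have c0 : 0 <= M%:R * 2 ^+ M * C by rewrite !mulr_ge0// exprn_ge0.
exists (M%:R * 2 ^+ M * C) => // u mu.
apply: le_sqnorm => //; first exact: mfield_mulmx.
by move=> k kc; apply: nsq_mulmx => p q; exact: XC.
Qed.

Lemma inL2_mulmx (X : coords R N -> 'M[R[i]]_M) u : mcont X -> inL2 u ->
  inL2 (fun k => X k *m u k).
Proof.
move=> Xc [mu u2]; have [c c0 cX] := sqnorm_mulmx Xc.
split; first exact: mfield_mulmx.
by apply: (le_lt_trans (cX _ mu)); rewrite lte_mul_pinfty.
Qed.

Lemma inL2Z (a : R[i]) u : inL2 u -> inL2 (fun k => a *: u k).
Proof.
move=> u2; have := inL2_mulmx (mcont_cst N (a%:M : 'M[R[i]]_M)) u2.
by under eq_fun do rewrite mul_scalar_mx.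
Qed.

Lemma inL2D u v : inL2 u -> inL2 v -> inL2 (fun k => u k + v k).
Proof.
move=> [mu u2] [mv v2]; split; first exact: mfieldD.
by apply: (le_lt_trans (sqnormD mu mv)); rewrite lte_add_pinfty// lte_mul_pinfty.
Qed.

Lemma inL2_comb (a : R[i]) u v : inL2 u -> inL2 v -> inL2 (fun k => a *: u k + v k).
Proof. by move=> u2 v2; apply: inL2D => //; exact: inL2Z. Qed.

End L2_calculus.

Section bounded_linear_calculus.
Context (R : realType) (N M : nat).
Notation field := (coords R N -> 'cV[R[i]]_M).
Implicit Types (u v : field) (T B : field -> field).

Lemma eqL2_cube u v : (forall k, cube R N k -> u k = v k) -> eqL2 u v.
Proof. by move=> uv; apply: aeW => k; exact: uv. Qed.

Lemma eqL2_trans v u w : eqL2 u v -> eqL2 v w -> eqL2 u w.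
Proof. by apply: filterS2 => k uv vw kc; rewrite uv// vw. Qed.

Lemma eqL2D u u' v v' : eqL2 u u' -> eqL2 v v' ->
  eqL2 (fun k => u k + v k) (fun k => u' k + v' k).
Proof. by apply: filterS2 => k uu vv kc; rewrite uu// vv. Qed.

Let nsq_ae (u : field) : inL2 u -> sqnorm u = 0%E <-> eqL2 u (fun=> 0).
Proof.
move=> [mu u2].
have mc := @measurable_cube R N.
have mnu : measurable_fun (cube R N) (fun k => (nsq (u k))%:E).
  by apply/measurable_EFinP; exact: measurable_nsq.
have := ae_eq_integral_abs (lebesgue_cube R N) mc mnu.
rewrite (eq_integral (fun k => (nsq (u k))%:E)); last first.
  by move=> k _; rewrite gee0_abs// lee_fin nsq_ge0.
rewrite -/(sqnorm u) => -[H1 H2]; split=> [/H1|u0].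
  by apply: filterS => k uk kc; apply: nsq0_eq0; have [] := uk kc.
by apply: H2; move: u0; apply: filterS => k uk kc; rewrite uk// nsq0.
Qed.

Lemma sqnorm_eq0 u : inL2 u -> sqnorm u = 0%E -> eqL2 u (fun=> 0).
Proof. by move=> u2 /(nsq_ae u2). Qed.

Lemma eqL2_sqnorm0 u : inL2 u -> eqL2 u (fun=> 0) -> sqnorm u = 0%E.
Proof. by move=> u2 /(nsq_ae u2). Qed.

Lemma eqL2_sqnorm u v : inL2 u -> inL2 v -> eqL2 u v -> sqnorm u = sqnorm v.
Proof.
move=> [mu _] [mv _] uv; apply: ae_eq_integral => //.
- exact: measurable_cube.
- by apply/measurable_EFinP; exact: (measurable_nsq mu).
- by apply/measurable_EFinP; exact: (measurable_nsq mv).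
- by move: uv; apply: filterS => k uvk kc; rewrite uvk.
Qed.

(** [B] acts on functions, not on classes. If [u] and [v] agree almost everywhere then [v - u] has
    norm 0, so its image has norm 0 by the bound, and that image is [B v - B u] almost everywhere by
    linearity. *)
Lemma bounded_linear_congr B u v : bounded_linear B -> inL2 u -> inL2 v ->
  eqL2 u v -> eqL2 (B u) (B v).
Proof.
move=> [B2 BL [c Bc]] u2 v2 uv.
pose w : field := fun k => (-1) *: u k + v k.
have w2 : inL2 w by exact: inL2_comb.
have w0 : sqnorm w = 0%E.
  apply: eqL2_sqnorm0 => //; move: uv; apply: filterS => k uvk kc.
  by rewrite /w uvk// scaleN1r addNr.
have Bw0 : sqnorm (B w) = 0%E.
  apply/eqP; rewrite eq_le sqnorm_ge0 andbT.
  by apply: (le_trans (Bc _ w2)); rewrite w0 mule0.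
have := sqnorm_eq0 (B2 _ w2) Bw0; have := BL (-1) _ _ u2 v2.
apply: filterS2 => k h1 h2 kc.
have /eqP := h2 kc; rewrite h1// scaleN1r addrC subr_eq0 => /eqP.
by [].
Qed.

Lemma bounded_linearD_eq B u v : bounded_linear B -> inL2 u -> inL2 v ->
  eqL2 (B (fun k => u k + v k)) (fun k => B u k + B v k).
Proof.
move=> [B2 BL Bc] u2 v2; have := BL 1 _ _ u2 v2.
by under eq_fun do rewrite scale1r; under [X in eqL2 _ X]eq_fun do rewrite scale1r.
Qed.

Lemma bounded_linearB_eq B u v : bounded_linear B -> inL2 u -> inL2 v ->
  eqL2 (B (fun k => u k - v k)) (fun k => B u k - B v k).
Proof.
move=> [B2 BL Bc] u2 v2; have := BL (-1) _ _ v2 u2.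
under eq_fun do rewrite scaleN1r addrC.
by under [X in eqL2 _ X]eq_fun do rewrite scaleN1r addrC.
Qed.

Lemma bounded_linear_ext T B : bounded_linear T ->
  (forall u k, B u k = T u k) -> bounded_linear B.
Proof.
move=> Tb BT; suff -> : B = T by [].
by apply/funext => u; apply/funext => k.
Qed.

(** Boundedness is stated with a squared constant, so a bound between squared norms has to be given
    a root. *)
Let sqr_bound (c : R) : 0 <= c -> exists c', c = c' ^+ 2.
Proof. by move=> c0; exists (Num.sqrt c); rewrite sqr_sqrtr. Qed.

Lemma bounded_linear_mulmx (X : coords R N -> 'M[R[i]]_M) : mcont X ->
  bounded_linear (fun u k => X k *m u k).
Proof.
move=> Xc; split.
- by move=> u; exact: inL2_mulmx.
- move=> a u v _ _; apply: eqL2_cube => k _.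
  by rewrite mulmxDr -scalemxAr.
- have [c c0 cX] := sqnorm_mulmx Xc; have [c' cE] := sqr_bound c0.
  by exists c' => u [mu _]; rewrite -cE; exact: cX.
Qed.

Lemma bounded_linearD T B : bounded_linear T -> bounded_linear B ->
  bounded_linear (fun u k => T u k + B u k).
Proof.
move=> [T2 TL [c Tc]] [B2 BL [c' Bc]]; split.
- by move=> u u2; apply: inL2D; [exact: T2|exact: B2].
- move=> a u v u2 v2; have := TL a u v u2 v2; have := BL a u v u2 v2.
  by apply: filterS2 => k Bk Tk kc; rewrite Bk// Tk// scalerDr addrACA.
- have [d dE] : exists d, 2 * c ^+ 2 + 2 * c' ^+ 2 = d ^+ 2.
    by apply: sqr_bound; rewrite addr_ge0// mulr_ge0// sqr_ge0.
  exists d => u u2; rewrite -dE.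
  have [mT _] := T2 _ u2; have [mB _] := B2 _ u2.
  apply: (le_trans (sqnormD mT mB)).
  have P (x : R) : (0 <= (2 * x ^+ 2)%:E)%E by rewrite lee_fin mulr_ge0 ?sqr_ge0.
  rewrite [in leRHS]EFinD ge0_muleDl//.
  apply: leeD.
    by rewrite [X in (_ <= X * _)%E]EFinM -muleA lee_wpmul2l ?lee_fin//; exact: Tc.
  by rewrite [X in (_ <= X * _)%E]EFinM -muleA lee_wpmul2l ?lee_fin//; exact: Bc.
Qed.

Lemma bounded_linear_comp T B : bounded_linear T -> bounded_linear B ->
  bounded_linear (fun u => T (B u)).
Proof.
move=> Tb Bb; have [T2 TL [c Tc]] := Tb; have [B2 BL [c' Bc]] := Bb; split.
- by move=> u u2; exact/T2/B2.
- move=> a u v u2 v2.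
  apply: (eqL2_trans (v := T (fun k => a *: B u k + B v k))).
    apply: bounded_linear_congr => //; last exact: BL.
      exact/B2/inL2_comb.
    by apply: inL2_comb; exact: B2.
  by apply: TL; exact: B2.
- exists (c * c') => u u2; apply: (le_trans (Tc _ (B2 _ u2))).
  rewrite exprMn [X in (_ <= X * _)%E]EFinM -muleA lee_wpmul2l ?lee_fin ?sqr_ge0//; exact: Bc.
Qed.

Lemma bounded_linearN T : bounded_linear T -> bounded_linear (fun u k => - T u k).
Proof.
move=> Tb; have := bounded_linear_comp (bounded_linear_mulmx (mcont_cst N (-1)%:M)) Tb.
by move=> /bounded_linear_ext; apply=> u k; rewrite mul_scalar_mx scaleN1r.
Qed.

(** * Averaging over the first variables as a bounded operator *)

Section prefix.
Context (j : nat) (jN : (j <= N)%N).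

(** Extension by zero outside the cube: the earlier results on averages integrate over all tuples,
    those needed here over the cube. *)
Let res (f : coords R N -> R) := f \_ (cube R N).

Let measurable_res f : measurable_fun (cube R N) f -> measurable_fun setT (res f).
Proof. by move=> mf; apply/(measurable_restrictT _ _).1 => //; exact: measurable_cube. Qed.

Let res_section f k : cube R N k ->
  (fun t : coords R j => res f (set_prefix t k)) =
  (fun t => f (set_prefix t k)) \_ (cube R j).
Proof.
move=> kc; apply/funext => t; rewrite /res !patchE.
congr (if _ then _ else _); apply/idP/idP => /set_mem tc; apply/mem_set.
  exact: set_prefix_cubeN tc.
exact: set_prefix_cube.
Qed.

Let Rintegral_section f k : cube R N k ->
  \int[lebesgue_cube R j]_(t in cube R j) f (set_prefix t k)
  = \int[lebesgue_cube R j]_t res f (set_prefix t k).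
Proof. by move=> kc; rewrite Rintegral_mkcond res_section. Qed.

Let sqr_res f : (\int[lebesgue_cube R N]_k ((res f k) ^+ 2)%:E
  = \int[lebesgue_cube R N]_(k in cube R N) ((f k) ^+ 2)%:E)%E.
Proof.
rewrite [RHS]integral_mkcond; apply: eq_integral => k _.
by rewrite /res !patchE; case: ifP => // _; rewrite expr0n.
Qed.

Let measurable_section f : measurable_fun (cube R N) f ->
  measurable_fun (cube R N)
    (fun k => \int[lebesgue_cube R j]_(t in cube R j) f (set_prefix t k)).
Proof.
move=> mf.
apply: (eq_measurable_fun (fun k => \int[lebesgue_cube R j]_t res f (set_prefix t k))).
  by move=> k /set_mem kc; rewrite (Rintegral_section f kc).
apply: measurable_funTS.
exact: (measurable_partial_integral j (measurable_res mf)).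
Qed.

Let section_sqr_le (f : coords R N -> R) (A : set (coords R N)) (c : R) : measurable A -> 0 < c ->
  (forall k, lebesgue_cube R j [set t | A (set_prefix t k)] <= c%:E)%E ->
  measurable_fun (cube R N) f -> (forall k, cube R N k -> ~ A k -> f k = 0) ->
  (\int[lebesgue_cube R N]_(k in cube R N)
     ((\int[lebesgue_cube R j]_(t in cube R j) f (set_prefix t k))%R ^+ 2)%:E
   <= c%:E * \int[lebesgue_cube R N]_(k in cube R N) ((f k) ^+ 2)%:E)%E.
Proof.
move=> mA c0 Ac mf fA; rewrite -[in leRHS]sqr_res.
have H := @partial_integral_sqr_le R j N jN A c (res f) mA c0 Ac (measurable_res mf).
apply: le_trans (H _); last first.
  by move=> k nA; rewrite /res patchE; case: ifPn => // /set_mem kc; exact: fA.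
rewrite (eq_integral (fun k =>
  ((\int[lebesgue_cube R j]_t res f (set_prefix t k))%R ^+ 2)%:E)); last first.
  by move=> k /set_mem kc; rewrite (Rintegral_section f kc).
apply: ge0_subset_integral => //; first exact: measurable_cube.
  apply/measurable_EFinP/measurable_funX.
  exact: (measurable_partial_integral j (measurable_res mf)).
by move=> k _; rewrite lee_fin sqr_ge0.
Qed.

Lemma sqnorm_sum u : mfield u -> (sqnorm u = \sum_(p < M)
  (\int[lebesgue_cube R N]_(k in cube R N) ((complex.Re (u k p ord0)) ^+ 2)%:E
   + \int[lebesgue_cube R N]_(k in cube R N) ((complex.Im (u k p ord0)) ^+ 2)%:E))%E.
Proof.
move=> mu; have mc := @measurable_cube R N.
rewrite /sqnorm; under eq_integral do rewrite -sumEFin.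
rewrite ge0_integral_sum//; last 2 first.
- move=> p; have [mu1 mu2] := mu p; apply/measurable_EFinP.
  by apply: measurable_funD; exact: measurable_funX.
- by move=> p k _; rewrite lee_fin addr_ge0 ?sqr_ge0.
apply: eq_bigr => p _; have [mu1 mu2] := mu p.
under eq_integral do rewrite EFinD.
rewrite ge0_integralD//.
- by move=> k _; rewrite lee_fin sqr_ge0.
- by apply/measurable_EFinP; exact: measurable_funX.
- by move=> k _; rewrite lee_fin sqr_ge0.
- by apply/measurable_EFinP; exact: measurable_funX.
Qed.

Lemma mfield_prefix_integral u : mfield u -> mfield (prefix_integral j u).
Proof.
move=> mu p; have [mu1 mu2] := mu p; split; under eq_fun do rewrite mxE/=.
  exact: (measurable_section mu1).
exact: (measurable_section mu2).
Qed.

Lemma sqnorm_prefix_integral_le (A : set (coords R N)) (c : R) u :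
  measurable A -> 0 < c ->
  (forall k, lebesgue_cube R j [set t | A (set_prefix t k)] <= c%:E)%E ->
  mfield u -> (forall k, cube R N k -> ~ A k -> u k = 0) ->
  (sqnorm (prefix_integral j u) <= c%:E * sqnorm u)%E.
Proof.
move=> mA c0 Ac mu uA.
rewrite !sqnorm_sum//; last exact: mfield_prefix_integral.
rewrite ge0_sume_distrr; last first.
  by move=> p _; rewrite adde_ge0// integral_ge0// => k _; rewrite lee_fin sqr_ge0.
apply: lee_sum => p _; have [mu1 mu2] := mu p.
rewrite ge0_muleDr; [|by rewrite integral_ge0// => k _; rewrite lee_fin sqr_ge0..].
have reA k : cube R N k -> ~ A k -> complex.Re (u k p ord0) = 0.
  by move=> kc nA; rewrite uA// mxE.
have imA k : cube R N k -> ~ A k -> complex.Im (u k p ord0) = 0.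
  by move=> kc nA; rewrite uA// mxE.
apply: leeD; under eq_integral do rewrite mxE/=.
  exact: (section_sqr_le mA c0 Ac mu1 reA).
exact: (section_sqr_le mA c0 Ac mu2 imA).
Qed.

Lemma sqnorm_prefix_integral u : mfield u ->
  (sqnorm (prefix_integral j u) <= sqnorm u)%E.
Proof.
move=> mu; rewrite -[leRHS]mul1e.
apply: (sqnorm_prefix_integral_le (A := setT)) => // k; last by move=> _; case.
exact: (probability_le1 (lebesgue_cube R j) measurableT).
Qed.

Lemma inL2_prefix_integral u : inL2 u -> inL2 (prefix_integral j u).
Proof.
move=> [mu u2]; split; first exact: mfield_prefix_integral.
exact: le_lt_trans (sqnorm_prefix_integral mu) u2.
Qed.

(** Additivity of the average needs integrable fibres, and square integrability provides them only
    almost everywhere. This is why linearity of the average is an [eqL2] statement. *)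
Lemma inL2_section_integrable u : inL2 u ->
  {ae lebesgue_cube R N, forall k, cube R N k ->
    mx_integrable (lebesgue_cube R j) (cube R j) (fun t => u (set_prefix t k))}.
Proof.
move=> [mu]; rewrite sqnorm_sum// => u2.
have ge0 (f : coords R N -> R) :
    (0 <= \int[lebesgue_cube R N]_(k in cube R N) ((f k) ^+ 2)%:E)%E.
  by rewrite integral_ge0// => k _; rewrite lee_fin sqr_ge0.
have key (f : coords R N -> R) : measurable_fun (cube R N) f ->
    (\int[lebesgue_cube R N]_(k in cube R N) ((f k) ^+ 2)%:E < +oo)%E ->
    {ae lebesgue_cube R N, forall k, cube R N k ->
      (lebesgue_cube R j).-integrable (cube R j) (fun t => (f (set_prefix t k))%:E)}.
  move=> mf; rewrite -sqr_res => f2.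
  have := ae_integrable_section jN (integrable_sqr (measurable_res mf) f2).
  apply: filterS => k ki kc.
  rewrite (integrable_mkcond _ (@measurable_cube R j)).
  rewrite (@restrict_EFin _ _ (fun t => f (set_prefix t k)) (cube R j)).
  by rewrite -res_section.
have u2p p : ((\int[lebesgue_cube R N]_(k in cube R N) ((complex.Re (u k p ord0)) ^+ 2)%:E < +oo)
   /\ (\int[lebesgue_cube R N]_(k in cube R N) ((complex.Im (u k p ord0)) ^+ 2)%:E < +oo))%E.
  have H : (\int[lebesgue_cube R N]_(k in cube R N) ((complex.Re (u k p ord0)) ^+ 2)%:E
   + \int[lebesgue_cube R N]_(k in cube R N) ((complex.Im (u k p ord0)) ^+ 2)%:E < +oo)%E.
    apply: le_lt_trans u2; rewrite (bigD1 p)//= leeDl//.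
    by apply: sume_ge0 => q _; exact: adde_ge0.
  by split; apply: le_lt_trans H; [rewrite leeDl|rewrite leeDr].
have : {ae lebesgue_cube R N, forall k, forall p : 'I_M, cube R N k ->
  (lebesgue_cube R j).-integrable (cube R j)
    (fun t => (complex.Re (u (set_prefix t k) p ord0))%:E) /\
  (lebesgue_cube R j).-integrable (cube R j)
    (fun t => (complex.Im (u (set_prefix t k) p ord0))%:E)}.
  apply: filter_forall => p; have [mu1 mu2] := mu p; have [p1 p2] := u2p p.
  have := key _ mu1 p1; have := key _ mu2 p2.
  by apply: filterS2 => k k1 k2 kc; split; [exact: k2|exact: k1].
by apply: filterS => k kp kc p q; rewrite (ord1 q); exact: kp.
Qed.

Lemma bounded_linear_prefix_integral : bounded_linear (@prefix_integral R N M 1 j).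
Proof.
split.
- exact: inL2_prefix_integral.
- move=> a u v u2 v2; have := inL2_section_integrable u2.
  have := inL2_section_integrable v2; apply: filterS2 => k vi ui kc.
  have mc := @measurable_cube R j.
  rewrite /prefix_integral mx_integralD//; last exact: vi.
    by rewrite mx_integralZ//; exact: ui.
  by apply: mx_integrableZ => //; exact: ui.
- by exists 1 => u [mu _]; rewrite expr1n mul1e; exact: sqnorm_prefix_integral.
Qed.

End prefix.

End bounded_linear_calculus.

(** * Inverting the operator *)

Section resolvent.
Context (R : realType) (N M : nat).
Variable A : forall j : nat, coords R (N - j) -> 'M[R[i]]_M.
Arguments A : clear implicits.
Hypothesis hA : forall j : nat, (j <= N)%N -> cube_continuous (A j).
Variable lam : R[i].
Implicit Types (k : coords R N) (u : coords R N -> 'cV[R[i]]_M).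

Local Notation Finv := (cfrac_inv A lam).
Local Notation G := (Gmx A lam).
Local Notation S j := (coord_integral j (Finv j)).
Local Notation At j := (fun k => A j (tail j k)).

Definition Gunit j : Prop := forall k, cube R N k -> G j k \in unitmx.

Lemma mcont_coef j : (j <= N)%N -> mcont (At j).
Proof. by move=> jN; apply: mcont_cube_continuous; exact: hA. Qed.

Lemma eq_coef j k k' : drop j k = drop j k' -> A j (tail j k) = A j (tail j k').
Proof. by move=> kk'; congr (A j); exact/val_inj. Qed.

Lemma tail_invariant_Finv j : tail_invariant j (Finv j).
Proof.
elim: j => [|j IH] k k' kk' /=; first by rewrite (eq_coef kk').
rewrite (tail_invariant_coord_integral IH kk').
by rewrite (eq_coef kk').
Qed.

Lemma tail_invariant_G j : tail_invariant j (G j).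
Proof.
case: j => [|j] k k' kk' /=; first by rewrite (eq_coef kk').
rewrite (tail_invariant_coord_integral (@tail_invariant_Finv j) kk').
by rewrite (eq_coef kk').
Qed.

(** [cfrac_inv] is defined by cases on whether the average $S_j$ is invertible, which hides its
    continuity. Where the next $G$ is invertible both cases equal $G^{-1}S$, a continuous
    expression. *)
Lemma mcont_Finv j : (j <= N)%N -> (forall i, (i <= j)%N -> Gunit i) ->
  mcont (Finv j).
Proof.
have c0 : mcont (fun k => A 0 (tail 0 k) - lam%:M).
  by apply: mcontD; [exact: mcont_coef|exact: mcont_cst].
elim: j => [_ Gu|j IH jN Gu].
  by apply: mcont_invmx => // k kc; exact: (Gu 0%N).
have Sc : mcont (S j).
  by apply/mcont_coord_integral/IH => [|i ij]; [exact: ltnW|exact/Gu/ltnW].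
apply: (eq_mcont (F := fun k => invmx (G j.+1 k) *m S j k)).
  by move=> k kc; rewrite cfrac_invE//; exact: (Gu j.+1).
apply: mcontM => //; apply: mcont_invmx; first exact: Gu.
by apply: mcontD; [exact: mcont_cst|apply: mcontM => //; exact: mcont_coef].
Qed.

Lemma mcont_G j : (j <= N)%N -> (forall i, (i < j)%N -> Gunit i) -> mcont (G j).
Proof.
case: j => [_ _|j jN Gu].
  by apply: mcontD; [exact: mcont_coef|apply: mcont_cst].
apply: mcontD; first exact: mcont_cst.
apply: mcontM; last exact: mcont_coef.
by apply/mcont_coord_integral/mcont_Finv => //; exact: ltnW.
Qed.

(* The matrix [X_j] with [T_j (X_j w) = w] for functions [w] of [k_j] only. *)
Fixpoint Xmx j : coords R N -> 'M[R[i]]_M :=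
  match j with
  | 0 => Finv 0
  | i.+1 => fun k => Xmx i k *m (1%:M - A i.+1 (tail i.+1 k) *m Finv i.+1 k)
  end.

Lemma mcont_Xmx j : (j <= N)%N -> (forall i, (i <= j)%N -> Gunit i) ->
  mcont (Xmx j).
Proof.
elim: j => [|j IH] jN Gu; first exact: mcont_Finv.
apply: mcontM; first by apply: IH => [|i ij]; [exact: ltnW|exact/Gu/ltnW].
apply: mcontD; first exact: mcont_cst.
by apply/mcontN/mcontM; [exact: mcont_coef|exact: mcont_Finv].
Qed.

Let tail_invariant_step j :
  tail_invariant j (fun k => 1%:M - A j (tail j k) *m Finv j k).
Proof.
move=> k k' kk'; rewrite (tail_invariant_Finv kk').
by rewrite (eq_coef kk').
Qed.

(** Averaging the recursion gives $S(1-AG^{-1}S)=(G-SA)G^{-1}S$, and $G-SA=1$ by the definition of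
    $G$; what is left is $G^{-1}S=F^{-1}$. *)
Lemma prefix_integral_Xmx j : (j <= N)%N -> (forall i, (i <= j)%N -> Gunit i) ->
  forall k, cube R N k -> prefix_integral j (Xmx j) k = Finv j k.
Proof.
elim: j => [|j IH] jN Gu k kc; first by rewrite prefix_integral0.
have Gu' i : (i <= j)%N -> Gunit i by move=> ij; exact/Gu/ltnW.
have jN' := ltnW jN.
rewrite [LHS](prefix_integral_mulr (mcont_Xmx jN' Gu') (@tail_invariant_step j.+1))//.
rewrite prefix_integralS//; last exact: mcont_Xmx.
have -> : coord_integral j (prefix_integral j (Xmx j)) k = S j k.
  by apply: eq_coord_integral => //; exact: IH.
have uG : G j.+1 k \in unitmx by exact: Gu.
rewrite [in LHS](cfrac_invE uG) [in RHS](cfrac_invE uG).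
rewrite mulmxBr mulmx1 !mulmxA -[X in X - _]mul1mx -mulmxBl; congr (_ *m _).
set s := coord_integral _ _ _; set a := A _ _.
rewrite -[X in X - _](mulmxV uG) -mulmxBl.
by rewrite [X in (X - _) *m _]/= -/s -/a addrK mul1mx.
Qed.

Lemma prefix_integralS_Xmx j : (j < N)%N -> (forall i, (i <= j)%N -> Gunit i) ->
  forall k, cube R N k -> prefix_integral j.+1 (Xmx j) k = S j k.
Proof.
move=> jN Gu k kc; rewrite prefix_integralS//; last by apply: mcont_Xmx => //; exact: ltnW.
by apply: eq_coord_integral => //; apply: prefix_integral_Xmx => //; exact: ltnW.
Qed.

(* [T_j = A_0 - lam + sum_(1 <= i <= j) A_i < . >_{1,i}] *)
Definition opT j u k : 'cV[R[i]]_M :=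
  (A 0 (tail 0 k) - lam%:M) *m u k
  + \sum_(1 <= i < j.+1) A i (tail i k) *m prefix_integral i u k.

Lemma opTS j u k : opT j.+1 u k
  = opT j u k + A j.+1 (tail j.+1 k) *m prefix_integral j.+1 u k.
Proof. by rewrite /opT big_nat_recr//= addrA. Qed.

Lemma opT0 u k : opT 0 u k = (A 0 (tail 0 k) - lam%:M) *m u k.
Proof. by rewrite /opT big_geq// addr0. Qed.

Lemma opTN u k : opT N u k = opA A u k - lam *: u k.
Proof. by rewrite /opT /opA mulmxBl mul_scalar_mx addrAC. Qed.

(** In the step from $j$ to $j+1$, $X_{j+1}w$ is $X_j$ applied to $(1-AF^{-1})w$, again a function
    of the tail, so $T_j$ returns $(1-AF^{-1})w$. The new term adds $A\langle
    X_{j+1}w\rangle=AF^{-1}w$, the missing part. *)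
Lemma opT_Xmx j w : (j <= N)%N -> (forall i, (i <= j)%N -> Gunit i) ->
  tail_invariant j w -> forall k, cube R N k ->
  opT j (fun k => Xmx j k *m w k) k = w k.
Proof.
elim: j w => [|j IH] w jN Gu wj k kc.
  by rewrite opT0 /= mulmxA mulmxV ?mul1mx//; exact: (Gu 0%N).
rewrite opTS (prefix_integral_mulr _ wj)//; last exact: mcont_Xmx.
rewrite prefix_integral_Xmx//.
have -> : (fun k => Xmx j.+1 k *m w k) = (fun k => Xmx j k *m
    ((1%:M - A j.+1 (tail j.+1 k) *m Finv j.+1 k) *m w k)).
  by apply/funext => k'; rewrite mulmxA.
rewrite (IH (fun k => (1%:M - A j.+1 (tail j.+1 k) *m Finv j.+1 k) *m w k))//.
- by rewrite mulmxA mulmxBl mul1mx subrK.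
- exact: ltnW.
- by move=> i ij; exact/Gu/ltnW.
- apply: (tail_invariant_le (leqnSn j)) => k1 k2 k12.
  rewrite (eq_coef k12).
  by rewrite (tail_invariant_Finv k12) (wj _ _ k12).
Qed.

Lemma bounded_linear_opT j : (j <= N)%N -> bounded_linear (opT j).
Proof.
elim: j => [_|j IH jN].
  have c0 : mcont (fun k => A 0 (tail 0 k) - lam%:M).
    by apply: mcontD; [exact: mcont_coef|exact: mcont_cst].
  by apply: (bounded_linear_ext (bounded_linear_mulmx c0)) => u k; exact: opT0.
have := bounded_linear_comp (bounded_linear_mulmx (mcont_coef jN))
          (@bounded_linear_prefix_integral R N M _ jN).
move=> /(bounded_linearD (IH (ltnW jN))) /bounded_linear_ext; apply => u k.
exact: opTS.
Qed.

(** Writing $y=\langle u\rangle_{1,j+1}$, the equation $T_{j+1}u=f$ reads $T_ju=f-Ay$, so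
    $u=T_j^{-1}f-X_jAy$ because $Ay$ depends on the tail only. Averaging gives $y=\langle
    T_j^{-1}f\rangle-SAy$, that is $Gy=\langle T_j^{-1}f\rangle$. *)
Fixpoint invT j : (coords R N -> 'cV[R[i]]_M) -> coords R N -> 'cV[R[i]]_M :=
  match j with
  | 0 => fun f k => Finv 0 k *m f k
  | i.+1 => fun f k => invT i f k - (Xmx i k *m A i.+1 (tail i.+1 k)
      *m invmx (G i.+1 k)) *m prefix_integral i.+1 (invT i f) k
  end.

Lemma bounded_linear_invT j : (j <= N)%N -> (forall i, (i <= j)%N -> Gunit i) ->
  bounded_linear (invT j).
Proof.
elim: j => [|j IH] jN Gu; first by apply: bounded_linear_mulmx; exact: mcont_Finv.
have Gu' i : (i <= j)%N -> Gunit i by move=> ij; exact/Gu/ltnW.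
have Bb := IH (ltnW jN) Gu'.
apply: bounded_linearD => //; apply: bounded_linearN.
apply: (bounded_linear_comp (T := fun u k => _ *m u k)); last first.
  by apply: bounded_linear_comp => //; exact: bounded_linear_prefix_integral.
apply: bounded_linear_mulmx; apply: mcontM.
  by apply: mcontM; [apply: mcont_Xmx => //; exact: ltnW|exact: mcont_coef].
by apply: mcont_invmx; [exact: Gu|exact: mcont_G].
Qed.

Lemma invT_opT j : (j <= N)%N -> (forall i, (i <= j)%N -> Gunit i) ->
  forall u, inL2 u -> eqL2 (opT j (invT j u)) u /\ eqL2 (invT j (opT j u)) u.
Proof.
elim: j => [|j IH] jN Gu u u2.
  split; apply: eqL2_cube => k kc; rewrite /= opT0 mulmxA.
    by rewrite mulmxV ?mul1mx//; exact: (Gu 0%N).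
  by rewrite mulVmx ?mul1mx//; exact: (Gu 0%N).
have Gu' i : (i <= j)%N -> Gunit i by move=> ij; exact/Gu/ltnW.
have jN' := ltnW jN.
have Tb := bounded_linear_opT jN'; have Bb := bounded_linear_invT jN' Gu'.
have Pb := @bounded_linear_prefix_integral R N M _ jN.
have [T2 _ _] := Tb; have [B2 _ _] := Bb; have [P2 _ _] := Pb.
have Xc := mcont_Xmx jN' Gu'; have Ac := mcont_coef jN.
have Gc : mcont (fun k => invmx (G j.+1 k)).
  by apply: mcont_invmx; [exact: Gu|exact: mcont_G].
have Xw2 w : inL2 w -> inL2 (fun k => Xmx j k *m w k) by move=> ?; exact: inL2_mulmx.
have PXw w k : tail_invariant j.+1 w -> cube R N k ->
    prefix_integral j.+1 (fun k => Xmx j k *m w k) k = S j k *m w k.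
  by move=> wj kc; rewrite (prefix_integral_mulr Xc wj)// prefix_integralS_Xmx.
have TXw w k : tail_invariant j.+1 w -> cube R N k ->
    opT j (fun k => Xmx j k *m w k) k = w k.
  by move=> wj kc; rewrite opT_Xmx//; exact: tail_invariant_le wj.
have aw_tail w : tail_invariant j.+1 w ->
    tail_invariant j.+1 (fun k => A j.+1 (tail j.+1 k) *m w k).
  move=> wj k k' kk'; rewrite (wj _ _ kk').
  by rewrite (eq_coef kk').
split.
- pose g := invT j u; have g2 : inL2 g by exact: B2.
  (* [y] is the average that the candidate solution must have: averaging $g-X_jw$ gives $Gy-Sw=y$,
     which turns the new term of $T_{j+1}$ into $w$. *)
  pose y k := invmx (G j.+1 k) *m prefix_integral j.+1 g k.
  have y2 : inL2 y by apply: inL2_mulmx => //; exact: P2.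
  have yj : tail_invariant j.+1 y.
    move=> k k' kk'; rewrite /y (tail_invariant_G kk').
    by rewrite (tail_invariant_prefix_integral _ kk').
  pose w k := A j.+1 (tail j.+1 k) *m y k.
  have w2 : inL2 w by exact: inL2_mulmx.
  have wj : tail_invariant j.+1 w by exact: aw_tail.
  have -> : invT j.+1 u = (fun k => g k - Xmx j k *m w k).
    by apply/funext => k; rewrite /= -!mulmxA.
  have [Tg _] := IH jN' Gu' u u2.
  have H1 := bounded_linearB_eq Tb g2 (Xw2 _ w2).
  have H2 := bounded_linearB_eq Pb g2 (Xw2 _ w2).
  apply: filterS3 Tg H1 H2 => k Tg H1 H2 kc.
  rewrite opTS H1// H2// Tg// TXw// PXw//.
  have uG : G j.+1 k \in unitmx by exact: Gu.
  have -> : prefix_integral j.+1 g k = G j.+1 k *m y k.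
    by rewrite /y mulmxA mulmxV// mul1mx.
  have -> : G j.+1 k *m y k - S j k *m w k = y k.
    by rewrite [G _ _]/= mulmxDl mul1mx /w mulmxA addrK.
  by rewrite /w subrK.
- have Pu2 := P2 _ u2.
  pose w k := A j.+1 (tail j.+1 k) *m prefix_integral j.+1 u k.
  have w2 : inL2 w by exact: inL2_mulmx.
  have wj : tail_invariant j.+1 w.
    by apply: aw_tail; exact: tail_invariant_prefix_integral.
  (* On the cube [w] is [opT j] of $X_jw$, so the left-inverse half of the induction hypothesis,
     applied to $X_jw$, identifies [invT j w]. *)
  have Bw : eqL2 (invT j w) (fun k => Xmx j k *m w k).
    apply: (eqL2_trans (v := invT j (opT j (fun k => Xmx j k *m w k)))).
      apply: bounded_linear_congr => //; first exact/T2/Xw2.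
      by apply: eqL2_cube => k kc; rewrite TXw.
    by have [_] := IH jN' Gu' _ (Xw2 _ w2).
  pose g := invT j (opT j.+1 u).
  have T2u := T2 _ u2.
  have opTE : opT j.+1 u = (fun k => opT j u k + w k).
    by apply/funext => k; exact: opTS.
  have g2 : inL2 g by rewrite /g opTE; exact: (B2 _ (inL2D T2u w2)).
  have gE : eqL2 g (fun k => u k + Xmx j k *m w k).
    rewrite /g opTE; apply: (eqL2_trans (bounded_linearD_eq Bb T2u w2)).
    by apply: eqL2D => //; have [] := IH jN' Gu' u u2.
  have uXw2 := inL2D u2 (Xw2 _ w2).
  have Pg := bounded_linear_congr Pb g2 uXw2 gE.
  have PuXw := bounded_linearD_eq Pb u2 (Xw2 _ w2).
  apply: filterS3 gE Pg PuXw => k gE Pg PuXw kc.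
  have uG : G j.+1 k \in unitmx by exact: Gu.
  rewrite [LHS]/= -/(g k) -/g gE// Pg// PuXw// PXw//.
  (* Since $g=u+X_jw$, its average is $G$ times that of $u$. Hence $G^{-1}$ recovers the average of
     $u$, and the correction subtracted by [invT] is exactly $X_jw$. *)
  have -> : prefix_integral j.+1 u k + S j k *m w k
          = G j.+1 k *m prefix_integral j.+1 u k.
    by rewrite [G _ _]/= mulmxDl mul1mx /w mulmxA.
  by rewrite mulmxA mulmxKV// -mulmxA addrK.
Qed.

Lemma resolvent_setP : (forall j, (j <= N)%N -> Gunit j) -> resolvent_set (opA A) lam.
Proof.
move=> Gu; exists (invT N); split; first exact: bounded_linear_invT.
move=> u u2; have [H1 H2] := invT_opT (leqnn N) Gu u2.
have E w : (fun k => opA A w k - lam *: w k) = opT N w.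
  by apply/funext => k; rewrite opTN.
by rewrite !E.
Qed.

End resolvent.

(** * Approximate eigenfunctions *)

Section localisation.
Context (R : realType).

Definition centred_itv (a d : R) : set (measurableTypeR R) :=
  `]a - d, a + d[%classic.

Lemma measurable_centred_itv a d : measurable (centred_itv a d).
Proof. exact: measurable_itv. Qed.
Hint Resolve measurable_centred_itv : core.

Lemma lebesgue01_centred_itv_le (a d : R) : 0 < d ->
  (@lebesgue01 R (centred_itv a d) <= (2 * d)%:E)%E.
Proof.
move=> d0; have E : (2 * d)%:E = lebesgue_measure (centred_itv a d).
  rewrite /centred_itv lebesgue_measure_itv/= lte_fin ifT; last by lra.
  by rewrite -EFinB; congr EFin; lra.
rewrite E /lebesgue01 /mrestr; apply: le_measure; rewrite ?inE//=.
exact: measurableI.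
Qed.

(** The centre may be an endpoint of [[0, 1]], where half of the interval is lost; the open interval
    from [lo] to [hi] always remains. *)
Lemma lebesgue01_centred_itv_gt0 (a d : R) : 0 < d -> 0 <= a <= 1 ->
  (0 < @lebesgue01 R (centred_itv a d `&` `[0%R, 1%R]%classic))%E.
Proof.
move=> d0 /andP[a0 a1].
pose lo := Num.max 0 (a - d); pose hi := Num.min 1 (a + d).
have lohi : lo < hi.
  by rewrite /lo /hi gt_max !lt_min ltr01/=; apply/andP; split; [|apply/andP; split]; lra.
apply: (@lt_le_trans _ _ (lebesgue_measure (`]lo, hi[%classic : set R))).
  by rewrite lebesgue_measure_itv/= lte_fin lohi -EFinB lte_fin subr_gt0.
rewrite /lebesgue01 /mrestr; apply: le_measure; rewrite ?inE//=.
  by apply: measurableI => //; exact: measurableI.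
move=> x /=; rewrite in_itv/= /lo /hi gt_max lt_min => /andP[/andP[x0 xa] /andP[x1 xd]].
by split; [split|]; rewrite /centred_itv/= in_itv/= ?xa ?xd ?(ltW x0) ?(ltW x1).
Qed.

(** When [j] is not below [n] no coordinate has index [j] and the slab is the whole space. This
    happens for [j = N], where $T_N$ has no further terms to estimate. *)
Definition slab n (j : nat) (I : set (measurableTypeR R)) : set (coords R n) :=
  box (fun l : 'I_n => if l == j :> nat then I else setT).

Lemma measurable_slab n j I : measurable I -> measurable (slab (n := n) j I).
Proof. by move=> mI; apply: measurable_box => l; case: ifP. Qed.

Lemma lebesgue_cube_slab n j I : (j < n)%N -> measurable I ->
  lebesgue_cube R n (slab (n := n) j I) = lebesgue01 I.
Proof.
move=> jn mI; rewrite box_lebesgue_cube; last by move=> l; case: ifP.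
rewrite (bigD1 (Ordinal jn))//= eqxx big1 ?mule1// => l lj.
rewrite ifF; first exact: probability_setT.
by apply/negbTE; move: lj; apply: contra => /eqP lj; apply/eqP/val_inj.
Qed.

Lemma slab_set_prefix N i j I (k : coords R N) : (j < i)%N -> (i <= N)%N ->
  [set t | slab (n := N) j I (set_prefix t k)] = slab (n := i) j I.
Proof.
move=> ji iN; apply/seteqP; split => t /= ts l.
  case: eqP => // lj.
  have li : (widen_ord iN l < i)%N by exact: (ltn_ord l).
  have := ts (widen_ord iN l); rewrite /= lj eqxx (tnth_set_prefixl _ _ li).
  by rewrite (_ : Ordinal li = l)//; exact/val_inj.
case: eqP => // lj; have li : (l < i)%N by rewrite lj.
rewrite (tnth_set_prefixl _ _ li).
have lj' : Ordinal li == j :> nat by rewrite /= lj.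
by have := ts (Ordinal li); rewrite lj'.
Qed.

Lemma rcont_near n (f : coords R n -> R) (a : coords R n) (e : R) :
  rcont f -> cube R n a -> 0 < e ->
  exists2 d : R, 0 < d & forall k, cube R n k ->
    (forall i, `|tnth a i - tnth k i : R| < d) -> `|f a - f k| < e.
Proof.
move=> fc ac e0.
have := (@cvgrPdist_lt _ _ _ _ (nbhs_filter (row_of a)) _ _).1 (fc (row_of a)) _ e0.
move=> /nbhs_ballP[d /= d0 dP]; exists d => // k kc ak.
have := dP (row_of k); rewrite /= !row_ofK//; apply.
by split => // i l; rewrite !mxE; exact: ak.
Qed.

Lemma rcont_nsq n m (F : coords R n -> 'cV[R[i]]_m) : mcont F ->
  rcont (fun k => nsq (F k)).
Proof.
move=> Fc; rewrite /nsq; elim: (index_enum 'I_m) => [|p r IH].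
  by under eq_fun do rewrite big_nil; move=> v; exact: (@cst_continuous _ _ (0 : R)).
under eq_fun do rewrite big_cons /csq !expr2.
have [F1 F2] := Fc p ord0.
exact: (rcontD (rcontD (rcontM F1 F1) (rcontM F2 F2)) IH).
Qed.

Lemma inL2_bounded N M (u : coords R N -> 'cV[R[i]]_M) (C : R) : mfield u ->
  (forall k, cube R N k -> nsq (u k) <= C) -> inL2 u.
Proof.
move=> mu uC; split => //.
have mc := @measurable_cube R N.
apply: (@le_lt_trans _ _ (\int[lebesgue_cube R N]_(k in cube R N) (`|C|)%:E)%E).
  apply: ge0_le_integral => //.
  - by move=> k _; rewrite lee_fin; exact: nsq_ge0.
  - by apply/measurable_EFinP; exact: (measurable_nsq mu).
  - by move=> k kc; rewrite lee_fin; exact: le_trans (uC k kc) (ler_norm _).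
rewrite integral_cst//; apply: (@le_lt_trans _ _ (`|C|%:E * 1)%E).
  by rewrite lee_wpmul2l ?lee_fin//; exact: probability_le1.
by rewrite mule1 ltry.
Qed.

Lemma mfield_indic N M (E : set (coords R N)) (Y : coords R N -> 'cV[R[i]]_M) :
  measurable E -> mcont Y -> mfield (fun k => (\1_E k)%:C%C *: Y k).
Proof.
move=> mE Yc p; have [Y1 Y2] := Yc p ord0.
have mI : measurable_fun (cube R N) (\1_E : coords R N -> R).
  by apply: measurable_funTS; exact: measurable_indic.
split.
  under eq_fun do rewrite mxE Re_mulc/= mul0r subr0.
  by apply: measurable_funM => //; exact: rcont_measurable.
under eq_fun do rewrite mxE Im_mulc/= mul0r addr0.
by apply: measurable_funM => //; exact: rcont_measurable.
Qed.

Lemma nsq_indic N M (E : set (coords R N)) (y : 'cV[R[i]]_M) k :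
  nsq ((\1_E k)%:C%C *: y) = \1_E k * nsq y.
Proof.
rewrite nsqZ /csq/= expr0n addr0 indicE.
by case: (k \in E); rewrite ?expr1n ?expr0n.
Qed.

Lemma inL2_indic N M (E : set (coords R N)) (Y : coords R N -> 'cV[R[i]]_M) :
  measurable E -> mcont Y -> inL2 (fun k => (\1_E k)%:C%C *: Y k).
Proof.
move=> mE Yc; have [C CP] := rcont_bounded (rcont_nsq Yc).
apply: (inL2_bounded (C := C)); first exact: mfield_indic.
move=> k kc; rewrite nsq_indic indicE.
have := le_trans (ler_norm _) (CP k kc); have := nsq_ge0 (Y k).
by case: (k \in E); rewrite ?mul1r ?mul0r//; exact: le_trans.
Qed.

Lemma eq_sqnorm N M (u v : coords R N -> 'cV[R[i]]_M) :
  (forall k, cube R N k -> u k = v k) -> sqnorm u = sqnorm v.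
Proof. by move=> uv; apply: eq_integral => k /set_mem kc; rewrite uv. Qed.

Lemma sqnorm_fin N M (u : coords R N -> 'cV[R[i]]_M) : inL2 u ->
  exists2 x : R, 0 <= x & sqnorm u = x%:E.
Proof.
move=> [_ u2]; have u0 := sqnorm_ge0 u.
exists (fine (sqnorm u)); first exact: fine_ge0.
by rewrite fineK// ge0_fin_numE.
Qed.

End localisation.

Section spectrum.
Context (R : realType) (N M : nat).
Variable A : forall j : nat, coords R (N - j) -> 'M[R[i]]_M.
Arguments A : clear implicits.
Hypothesis hA : forall j : nat, (j <= N)%N -> cube_continuous (A j).
Variable lam : R[i].
Implicit Types (k : coords R N) (u : coords R N -> 'cV[R[i]]_M).

Local Notation opT := (opT A lam).

(* Each further term [A_n < u >_{1,n}], [n > j], integrates over [k_{j+1}], in which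
   [u] is supported on an interval of length [2 d]. *)
Lemma sqnorm_opT_slab j n (a : R) : (j <= n)%N -> (n <= N)%N ->
  exists2 D : R, 0 <= D & forall (d : R) u, 0 < d -> inL2 u ->
    (forall k, cube R N k ->
       ~ slab j (centred_itv a d) k -> u k = 0) ->
    (sqnorm (opT n u) <= D%:E * (sqnorm (opT j u) + d%:E * sqnorm u))%E.
Proof.
elim: n => [|n IH] jn nN.
  exists 1 => // d u d0 u2 us; rewrite mul1e.
  have -> : j = 0%N by lia.
  by rewrite leeDl// mule_ge0 ?sqnorm_ge0// lee_fin ltW.
have [->|jn1] := eqVneq j n.+1.
  exists 1 => // d u d0 u2 us; rewrite mul1e.
  by rewrite leeDl// mule_ge0 ?sqnorm_ge0// lee_fin ltW.
have {jn jn1} jn : (j <= n)%N by lia.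
have nN' := ltnW nN; have [D D0 DP] := IH jn nN'.
have [K K0 KP] := sqnorm_mulmx (mcont_coef hA nN).
(* Both factors 2 come from the bound on the squared norm of a sum; the last term has another factor
   2 from the length [2 * d] of the interval. *)
exists (2 * D + 4 * K) => [|d u d0 u2 us]; first by rewrite addr_ge0// mulr_ge0.
have [Tn2 _ _] := bounded_linear_opT hA lam nN'.
have [Tj2 _ _] := bounded_linear_opT hA lam (leq_trans jn nN').
have [P2 _ _] := @bounded_linear_prefix_integral R N M _ nN.
have Pu2 := P2 _ u2.
have APu2 : inL2 (fun k => A n.+1 (tail n.+1 k) *m prefix_integral n.+1 u k).
  exact: inL2_mulmx (mcont_coef hA nN) Pu2.
have -> : opT n.+1 u = (fun k => opT n u k
    + A n.+1 (tail n.+1 k) *m prefix_integral n.+1 u k).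
  by apply/funext => k; exact: opTS.
have H1 := sqnormD (Tn2 _ u2).1 APu2.1.
have H2 := DP d u d0 u2 us.
have H3 := KP _ Pu2.1.
have mI := measurable_centred_itv a d.
have d20 : 0 < 2 * d by lra.
have H4 : (sqnorm (prefix_integral n.+1 u) <= (2 * d)%:E * sqnorm u)%E.
  have sl k : (lebesgue_cube R n.+1
      [set t | slab j (centred_itv a d) (set_prefix t k)] <= (2 * d)%:E)%E.
    rewrite slab_set_prefix//.
    by rewrite lebesgue_cube_slab ?ltnS//; exact: lebesgue01_centred_itv_le.
  exact: (sqnorm_prefix_integral_le nN (@measurable_slab R N j _ mI) d20 sl u2.1 us).
apply: (le_trans H1).
have [x x0 xE] := sqnorm_fin (Tn2 _ u2); have [y y0 yE] := sqnorm_fin (Tj2 _ u2).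
have [z z0 zE] := sqnorm_fin u2; have [s s0 sE] := sqnorm_fin Pu2.
have [t t0 tE] := sqnorm_fin APu2.
move: H2 H3 H4; rewrite xE yE zE sE tE.
rewrite -!EFinM -?EFinD !lee_fin => H2 H3 H4.
have : K * s <= K * (2 * d * z) by rewrite ler_wpM2l.
have Ky : 0 <= K * y by exact: mulr_ge0.
have Ddz : 0 <= D * (d * z) by rewrite mulr_ge0// mulr_ge0// ltW.
nra.
Qed.

(** Let $b$ bound a left inverse and put $u=\phi Y$. Then $\|u\|^2\le b^2\|T_Nu\|^2\le b^2D(\|\phi
    Z\|^2+d\|u\|^2)\le 2b^2Dc\|u\|^2$, because $\|\phi Z\|^2\le c\|\phi Q\|^2\le c\|u\|^2$ and $d\le
    c$. For small $c$ this forces $\phi Q=0$ almost everywhere, although $\phi Q$ is nonzero on a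
    set of positive measure. The hypotheses quantify over $\phi$ because the box is chosen only
    after $b$ and $D$ are known. *)
Lemma approximate_eigenfunction j (Y Z Q : coords R N -> 'cV[R[i]]_M)
    (kappa : coords R N) : (j <= N)%N -> cube R N kappa ->
  mcont Y -> mcont Z -> mcont Q ->
  tail_invariant j Z -> tail_invariant j Q -> Z kappa = 0 -> Q kappa != 0 ->
  (forall phi : coords R N -> R[i], tail_invariant j phi ->
     forall k, cube R N k -> opT j (fun k => phi k *: Y k) k = phi k *: Z k) ->
  (forall phi : coords R N -> R[i], tail_invariant j phi ->
     forall k, cube R N k -> prefix_integral j (fun k => phi k *: Y k) k = phi k *: Q k) ->
  ~ resolvent_set (opA A) lam.
Proof.
move=> jN kc Yc Zc Qc Zj Qj Z0 Q0 HT HP [B [Bb BT]].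
have [B2 _ [b Bbound]] := Bb.
(* For [j = N] the default 0 is returned, harmlessly: the slab is then the whole space. *)
pose a : R := nth 0 kappa j.
have [D D0 DP] := sqnorm_opT_slab a jN (leqnn N).
pose q0 := nsq (Q kappa).
have q00 : 0 < q0.
  rewrite lt0r nsq_ge0 andbT; apply: contraNneq Q0 => /nsq0_eq0 ->.
  by rewrite eqxx.
(* Makes $2b^2Dc<1/2$; the summand 1 keeps the inverse meaningful when $b^2D=0$. *)
pose c := (4 * (b ^+ 2 * D + 1))^-1.
have bD0 : 0 <= b ^+ 2 * D by rewrite mulr_ge0// sqr_ge0.
have c0 : 0 < c by rewrite invr_gt0; nra.
have cE : 4 * (b ^+ 2 * D + 1) * c = 1 by rewrite mulfV// gt_eqF//; nra.
have q20 : 0 < q0 / 2 by rewrite divr_gt0.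
have [d1 d10 d1P] := rcont_near (rcont_nsq Qc) kc q20.
(* On the box $|Q|^2\ge q_0/2$ and $|Z|^2\le cq_0/2$, hence $|Z|^2\le c|Q|^2$ there. *)
have cq0 : 0 < c * (q0 / 2) by exact: mulr_gt0.
have [d2 d20 d2P] := rcont_near (rcont_nsq Zc) kc cq0.
pose d := Num.min c (Num.min d1 d2).
have d0 : 0 < d by rewrite !lt_min c0 d10.
have dc : d <= c by rewrite ge_min lexx.
have dd1 : d <= d1 by rewrite !ge_min lexx orbT.
have dd2 : d <= d2 by rewrite !ge_min lexx !orbT.
pose I (l : 'I_N) : set (measurableTypeR R) :=
  centred_itv (tnth kappa l) d.
pose E : set (coords R N) := box (fun l => if (l < j)%N then setT else I l).
have mI (l : 'I_N) : measurable (if (l < j)%N then setT else I l).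
  by case: ifP => // _; exact: measurable_centred_itv.
have mE : measurable E by exact: measurable_box.
pose phi k : R[i] := (\1_E k)%:C%C.
have Ej : tail_invariant j (fun k => k \in E).
  suff H k k' : drop j k = drop j k' -> E k -> E k'.
    by move=> k k' kk'; apply/idP/idP => /set_mem kE; apply/mem_set; apply: H kE.
  move=> kk' kE l; have := kE l; case: ltnP => // jl.
  by rewrite !(tnth_nth 0) -(subnKC jl) -!nth_drop kk'.
have phij : tail_invariant j phi.
  by move=> k k' kk'; rewrite /phi !indicE (Ej _ _ kk').
have near_kappa k : cube R N k -> E k ->
    nsq (Z k) <= c * (q0 / 2) /\ q0 / 2 <= nsq (Q k).
  move=> kcube kE.
  (* A point of [E] is close to [kappa] only from coordinate [j] on. Replacing its first [j]
     coordinates by those of [kappa] makes it close in all coordinates without changing [Z] or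
     [Q]. *)
  pose t : coords R j := [tuple nth 0 kappa l | l < j].
  have tE (l : 'I_N) (lj : (l < j)%N) : tnth (set_prefix t k) l = tnth kappa l.
    by rewrite (tnth_set_prefixl _ _ lj) tnth_mktuple (tnth_nth 0).
  have sc : cube R N (set_prefix t k).
    move=> l; have [lj|jl] := ltnP l j; first by rewrite tE.
    by rewrite tnth_set_prefixr.
  have sd l : `|tnth kappa l - tnth (set_prefix t k) l : R| < d.
    have [lj|jl] := ltnP l j; first by rewrite tE// subrr normr0.
    rewrite tnth_set_prefixr//; have := kE l; rewrite ltnNge jl /= /I /centred_itv/= in_itv/=.
    by move=> /andP[h1 h2]; rewrite ltr_norml; apply/andP; split; lra.
  rewrite -(tail_invariantP t k Zj) -(tail_invariantP t k Qj); split.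
    have := d2P _ sc (fun l => lt_le_trans (sd l) dd2).
    by rewrite Z0 nsq0 sub0r normrN => /ltW; exact: le_trans (ler_norm _).
  have := d1P _ sc (fun l => lt_le_trans (sd l) dd1).
  by rewrite ltr_norml -/q0 => /andP[_]; lra.
pose u k := phi k *: Y k.
have u2 : inL2 u by exact: inL2_indic.
have Q2 : inL2 (fun k => phi k *: Q k) by exact: inL2_indic.
have Z2 : inL2 (fun k => phi k *: Z k) by exact: inL2_indic.
have Qu : (sqnorm (fun k => phi k *: Q k) <= sqnorm u)%E.
  rewrite -(eq_sqnorm (HP phi phij)); apply: sqnorm_prefix_integral => //.
  exact: u2.1.
have ZQ : (sqnorm (fun k => (phi k *: Z k)%R) <= c%:E * sqnorm (fun k => (phi k *: Q k)%R))%E.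
  apply: le_sqnorm; [exact: Z2.1|exact: Q2.1|exact: ltW|] => k kcube.
  rewrite !nsq_indic indicE; have [/set_mem kE|_] := boolP (k \in E).
    by have [h1 h2] := near_kappa k kcube kE; rewrite !mul1r; nra.
  by rewrite !mul0r mulr0.
have us k : cube R N k -> ~ slab j (centred_itv a d) k -> u k = 0.
  move=> kcube nk; rewrite /u /phi indicE.
  have [/set_mem kE|_] := boolP (k \in E); last by rewrite scale0r.
  exfalso; apply: nk => l; case: eqP => // lj.
  by have := kE l; rewrite lj ltnn /I /a (tnth_nth 0) lj.
have T2 := bounded_linear_opT hA lam (leqnn N); have [T2' _ _] := T2.
have opTE : (fun k => opA A u k - lam *: u k) = opT N u.
  by apply/funext => k; rewrite opTN.
have Tu2 := T2' _ u2.
have [BTu _] := BT u u2; rewrite opTE in BTu.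
have H1 : (sqnorm u <= (b ^+ 2)%:E * sqnorm (opT N u))%E.
  rewrite -(eqL2_sqnorm (B2 _ Tu2) u2 BTu); exact: Bbound.
have H2 := DP d u d0 u2 us.
rewrite (eq_sqnorm (HT phi phij)) in H2.
have [x x0 xE] := sqnorm_fin u2; have [y y0 yE] := sqnorm_fin Tu2.
have [z z0 zE] := sqnorm_fin Z2; have [q q'0 qE] := sqnorm_fin Q2.
move: H1 H2 Qu ZQ; rewrite xE yE zE qE -!EFinM !lee_fin.
move=> H1 H2 Qu ZQ.
have q_eq0 : q = 0.
  have zc : z <= c * x by apply: (le_trans ZQ); rewrite ler_pM2l.
  have dx : d * x <= c * x by rewrite ler_wpM2r.
  have y_le : y <= D * (2 * (c * x)).
    by apply: (le_trans H2); rewrite ler_wpM2l//; lra.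
  have x_le : x <= b ^+ 2 * (D * (2 * (c * x))).
    by apply: (le_trans H1); rewrite ler_wpM2l// sqr_ge0.
  have cx0 : 0 <= c * x by rewrite mulr_ge0// ltW.
  have xE' : x = 4 * (b ^+ 2 * D + 1) * (c * x) by rewrite mulrA cE mul1r.
  have : 2 * (b ^+ 2 * D + 1) * (c * x) <= 0 by nra.
  have : 0 <= (b ^+ 2 * D) * (c * x) by exact: mulr_ge0.
  nra.
have Qae : eqL2 (fun k => phi k *: Q k) (fun=> 0).
  by apply: sqnorm_eq0 => //; rewrite qE q_eq0.
(* The almost-everywhere statement speaks only of points of the cube, so the box is intersected with
   it; its measure stays positive even if [kappa] lies on the boundary. *)
pose F : set (coords R N) :=
  box (fun l => (if (l < j)%N then setT else I l) `&` `[0, 1]%classic).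
have FE k : F k -> cube R N k /\ E k.
  by move=> Fk; split => l; have [EI] := Fk l; rewrite /= ?in_itv.
have mF : measurable F.
  by apply: measurable_box => l; exact: measurableI.
have : (0 < lebesgue_cube R N F)%E.
  rewrite box_lebesgue_cube; last by move=> l; exact: measurableI.
  apply: (big_ind (fun s : \bar R => 0 < s)%E) => [|s t|l _];
    [exact: lte01|exact: mule_gt0|].
  case: ifP => _; last exact: lebesgue01_centred_itv_gt0.
  by rewrite setTI /lebesgue01 /mrestr setIid lebesgue_measure_itv/= lte01 oppr0 adde0 lte01.
apply/negP; rewrite -leNgt.
have [W [mW W0 WP]] := Qae.
rewrite -W0; apply: le_measure; rewrite ?inE// => k /FE[kcube kE].
apply: WP => /= /(_ kcube) /eqP.
rewrite scaler_eq0 /phi indicE mem_set// oner_eq0 /= => /eqP Qk0.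
have [_] := near_kappa k kcube kE.
by rewrite Qk0 nsq0; lra.
Qed.

End spectrum.

(** * From a singular $G_j$ to the spectrum *)

Section singular.
Context (R : realType) (N M : nat).
Variable A : forall j : nat, coords R (N - j) -> 'M[R[i]]_M.
Arguments A : clear implicits.
Hypothesis hA : forall j : nat, (j <= N)%N -> cube_continuous (A j).
Variable lam : R[i].

Lemma GunitP j : ~ zeros A j lam <-> Gunit A lam j.
Proof.
split=> [nz k kc|Gu [k kc /eqP]].
  by rewrite unitmxE unitfE; apply/eqP => dG; apply: nz; exists k.
by apply/negP; have := Gu k kc; rewrite unitmxE unitfE.
Qed.

(** Invertibility of the earlier $G_i$ is what makes the matrix $X$ of the previous step exist and
    be continuous, and the approximate eigenfunction is built from it. *)
Lemma zeros_not_resolvent j : (j <= N)%N ->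
  (forall i, (i < j)%N -> Gunit A lam i) -> zeros A j lam ->
  ~ resolvent_set (opA A) lam.
Proof.
move=> jN Gu [kappa kc dG].
have [v v0 Gv] : exists2 v : 'cV[R[i]]_M, v != 0 & Gmx A lam j kappa *m v = 0.
  (* [det0P] yields a row vector in the left kernel; the transpose turns it into a column in the
     right kernel. *)
  have /det0P[w w0 wG] : \det (Gmx A lam j kappa)^T == 0 by rewrite det_tr dG.
  exists w^T; first by rewrite -(inj_eq trmx_inj) trmxK trmx0.
  by apply: trmx_inj; rewrite trmx_mul trmxK wG trmx0.
case: j => [|j] in jN Gu dG Gv *.
  apply: (@approximate_eigenfunction _ _ _ A hA lam 0 (fun=> v)
    (fun k => Gmx A lam 0 k *m v) (fun=> v) kappa) => //.
  - exact: mcont_cst.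
  - by apply: mcontM; [exact: mcont_G|exact: mcont_cst].
  - exact: mcont_cst.
  - by move=> k k' kk'; rewrite (tail_invariant_G A lam kk').
  - by move=> phi _ k _; rewrite opT0 -scalemxAr.
  - by move=> phi _ k _; rewrite prefix_integral0.
have jN' := ltnW jN.
have Xc := mcont_Xmx hA jN' Gu; have Ac := mcont_coef hA jN.
have Sc := mcont_coord_integral j (mcont_Finv hA jN' Gu).
have vc : mcont (fun _ : coords R N => v) by exact: mcont_cst.
pose S := coord_integral j (cfrac_inv A lam j).
pose a (k : coords R N) := A j.+1 (tail j.+1 k).
have YE (phi : coords R N -> R[i]) : (fun k => phi k *: (Xmx A lam j k *m (a k *m v)))
    = (fun k => Xmx A lam j k *m (phi k *: (a k *m v))).
  by apply/funext => k; rewrite scalemxAr.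
have pj (phi : coords R N -> R[i]) : tail_invariant j.+1 phi ->
    tail_invariant j.+1 (fun k => phi k *: (a k *m v)).
  by move=> phij k k' kk'; rewrite (phij _ _ kk') /a (eq_coef A kk').
have PY (phi : coords R N -> R[i]) : tail_invariant j.+1 phi ->
    forall k, cube R N k ->
    prefix_integral j.+1 (fun k => phi k *: (Xmx A lam j k *m (a k *m v))) k
    = phi k *: (S k *m (a k *m v)).
  move=> phij k kcube; rewrite YE (prefix_integral_mulr Xc (pj _ phij))//.
  by rewrite prefix_integralS_Xmx// -scalemxAr.
apply: (@approximate_eigenfunction _ _ _ A hA lam j.+1
  (fun k => Xmx A lam j k *m (a k *m v))
  (fun k => a k *m (Gmx A lam j.+1 k *m v))
  (fun k => S k *m (a k *m v)) kappa).
- exact: jN.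
- exact: kc.
- exact: mcontM Xc (mcontM Ac vc).
- exact: mcontM Ac (mcontM (mcont_G hA jN Gu) vc).
- exact: mcontM Sc (mcontM Ac vc).
- move=> k k' kk'.
  by rewrite /a (tail_invariant_G A lam kk') (eq_coef A kk').
- move=> k k' kk'; rewrite /a (eq_coef A kk') /S.
  by rewrite (tail_invariant_coord_integral (@tail_invariant_Finv _ _ _ A lam j) kk').
- by rewrite Gv mulmx0.
(* At [kappa], $SAv=Gv-v=-v$, so its vanishing would give $v=0$. *)
- apply: contraNneq v0 => Sv; apply/eqP.
  by rewrite -Gv /= mulmxDl mul1mx -mulmxA [X in _ + X]Sv addr0.
- move=> phi phij k kcube; rewrite opTS (PY _ phij _ kcube) YE.
  have pj' := tail_invariant_le (leqnSn j) (pj _ phij).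
  rewrite (opT_Xmx hA jN' Gu pj' kcube).
  by rewrite -scalemxAr -scalerDr [Gmx _ _ _ _]/= mulmxDl mul1mx mulmxDr -!mulmxA.
- exact: PY.
Qed.

(** Removing the earlier sets at each step does not change the union, so it can be computed with the
    plain zero sets. *)
Lemma sigma_belowP j : sigma_below A j lam <-> exists2 i, (i < j)%N & zeros A i lam.
Proof.
elim: j => [|j IH] /=; first by split => // -[].
split=> [[/IH[i ij zi]|[zj _]]|[l]].
- by exists i => //; exact: ltnW.
- by exists j.
rewrite ltnS leq_eqVlt => /predU1P[->|lj] zl.
  by have [sb|nsb] := pselect (sigma_below A j lam); [left|right].
by left; apply/IH; exists l.
Qed.

End singular.

Theorem theorem1p2 (R : realType) (N M : nat) (hN : (0 < N)%N) (hM : (0 < M)%N)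
    (A : forall j : nat, coords R (N - j) -> 'M[R[i]]_M)
    (hA : forall j : nat, (j <= N)%N -> cube_continuous (A j)) :
  spectrum (opA A) = \bigcup_(j in `I_N.+1) sigma A j.
Proof.
apply/seteqP; split => [lam nres|lam [j /= jN [zj nb]]].
  rewrite -sigma_belowE; apply: contrapT => ns; apply: nres.
  apply: resolvent_setP => // j jN; apply/GunitP => zj; apply: ns.
  by apply/sigma_belowP; exists j.
(* Lying outside [sigma_below] says precisely that [j] is the least index with a singular $G_j$. *)
apply: (zeros_not_resolvent hA jN _ zj) => i ij.
by apply/GunitP => zi; apply: nb; apply/sigma_belowP; exists i.
Qed.
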